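(* A Schur-class function $S\in{\mathcal S}_d({\mathcal U},{\mathcal Y})$ admits a contractive commutative realization if and only if there exist a Hilbert space ${\mathcal F}$ and $\widetilde S$ such that $\widehat S(\lambda)=\begin{bmatrix}S(\lambda)&\widetilde S(\lambda)\end{bmatrix}\in{\mathcal S}_d({\mathcal U}\oplus{\mathcal F},{\mathcal Y})$, the de Branges–Rovnyak space ${\mathcal H}(K_{\widehat S})$ is ${\mathbf M}_\lambda^*$-invariant, and $\sum_{j=1}^d\|M_{\lambda_j}^*f\|^2_{{\mathcal H}(K_{\widehat S})}\le\|f\|^2_{{\mathcal H}(K_{\widehat S})}-\|f(0)\|^2_{\mathcal Y}$ for every $f\in{\mathcal H}(K_{\widehat S})$.
   Context: Let ${\mathbb B}^d=\{\lambda\in{\mathbb C}^d:\langle\lambda,\lambda\rangle<1\}$. ${\mathcal H}_{\mathcal Y}(k_d)$ is the reproducing kernel Hilbert space of ${\mathcal Y}$-valued functions on ${\mathbb B}^d$ with kernel $k_d(\lambda,\zeta)I_{\mathcal Y}$, $k_d(\lambda,\zeta)=1/(1-\langle\lambda,\zeta\rangle)$. ${\mathcal S}_d({\mathcal U},{\mathcal Y})$ is the set of ${\mathcal L}({\mathcal U},{\mathcal Y})$-valued holomorphic $S$ on ${\mathbb B}^d$ such that $M_S:f\mapsto Sf$ is a contraction from ${\mathcal H}_{\mathcal U}(k_d)$ into ${\mathcal H}_{\mathcal Y}(k_d)$. For such $S$, ${\mathcal H}(K_S)$ is the reproducing kernel Hilbert space of $K_S(\lambda,\zeta)=\frac{I-S(\lambda)S(\zeta)^*}{1-\langle\lambda,\zeta\rangle}$.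 $M_{\lambda_j}^*$ is the adjoint in ${\mathcal H}_{\mathcal Y}(k_d)$ of multiplication by $\lambda_j$; ${\mathbf M}_\lambda^*$-invariant means invariant under all $M_{\lambda_j}^*$. A realization of $S$: Hilbert space ${\mathcal X}$, $A_j\in{\mathcal L}({\mathcal X})$, $B_j\in{\mathcal L}({\mathcal U},{\mathcal X})$, $C\in{\mathcal L}({\mathcal X},{\mathcal Y})$, $D\in{\mathcal L}({\mathcal U},{\mathcal Y})$ with $S(\lambda)=D+C(I-Z(\lambda)A)^{-1}Z(\lambda)B$, where $A=\mathrm{col}(A_j)$, $B=\mathrm{col}(B_j)$, $Z(\lambda)=[\lambda_1I\ \cdots\ \lambda_dI]$; it is contractive if ${\mathbf U}=\begin{bmatrix}A&B\\C&D\end{bmatrix}:{\mathcal X}\oplus{\mathcal U}\to{\mathcal X}^d\oplus{\mathcal Y}$ is a contraction and commutative if the $A_j$ pairwise commute. *)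

(* Defs.v *)
From HB Require Import structures.
From mathcomp Require Import all_boot all_order all_algebra.
From mathcomp Require Import complex.
From mathcomp Require Import classical_sets reals.
From Stdlib Require Import ClassicalEpsilon.

Set Implicit Arguments.
Unset Strict Implicit.
Unset Printing Implicit Defensive.

Import Order.TTheory GRing.Theory Num.Theory.
Local Open Scope ring_scope.
Local Open Scope complex_scope.

Section Defs.
Variable R : realType.
Local Notation C := R[i].

Record hilb := Hilb {
  hcar :> lmodType C;
  hip : hcar -> hcar -> C;
  hip_linl : forall (a : C) (x y z : hcar), hip (a *: x + y) z = a * hip x z + hip y z;
  hip_sym : forall x y : hcar, hip y x = (hip x y)^*;
  hip_pos : forall x : hcar, 0 <= hip x x;
  hip_def : forall x : hcar, hip x x = 0 -> x = 0;
  hip_complete : forall u : nat -> hcar,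
    (forall e : R, 0 < e -> exists N : nat, forall m n : nat, (N <= m)%N -> (N <= n)%N ->
        complex.Re (hip (u m - u n) (u m - u n)) < e) ->
    exists l : hcar, forall e : R, 0 < e -> exists N : nat, forall n : nat, (N <= n)%N ->
        complex.Re (hip (u n - l) (u n - l)) < e }.

Definition nsq (V : lmodType C) (ip : V -> V -> C) (x : V) : R := complex.Re (ip x x).

Definition ipsum (V W : lmodType C) (ipV : V -> V -> C) (ipW : W -> W -> C)
  (p q : V * W) : C := ipV p.1 q.1 + ipW p.2 q.2.

Definition bop (V W : lmodType C) (ipV : V -> V -> C) (ipW : W -> W -> C) (T : V -> W) :=
  (forall (a : C) (x y : V), T (a *: x + y) = a *: T x + T y) /\
  exists M : R, forall x : V, nsq ipW (T x) <= M * nsq ipV x.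

Definition adj (V W : lmodType C) (ipV : V -> V -> C) (ipW : W -> W -> C) (T : V -> W)
  (w : W) : V :=
  epsilon (inhabits (0 : V)) (fun v => forall x : V, ipW (T x) w = ipV x v).

Variable d : nat.
Definition pt := 'I_d -> C.
Definition dotC (l z : pt) : C := \sum_(j < d) l j * (z j)^*.
Definition inball (l : pt) : Prop := complex.Re (dotC l l) < 1.
Definition pt0 : pt := fun _ => 0.
Definition ptsub (l z : pt) : pt := fun j => l j - z j.
Definition kd (l z : pt) : C := (1 - dotC l z)^-1.

(** * Reproducing kernel Hilbert spaces of Y-valued functions on B^d.
   For an L(Y)-valued kernel K, f lies in H(K) with ||f||^2 <= c iff the
   kernel c K(l,z) - f(l) f(z)^*  is positive, i.e. for all finite families
   (l_i, y_i) of points of the ball and vectors of Y,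
   |sum_i <f(l_i), y_i>|^2 <= c sum_{i,k} <K(l_i,l_k) y_k, y_i>. *)
Section RKHS.
Variables (Y : lmodType C) (ipY : Y -> Y -> C) (K : pt -> pt -> Y -> Y).

Definition rk_bound (f : pt -> Y) (c : R) : Prop :=
  0 <= c /\
  forall (n : nat) (ls : 'I_n -> pt) (ys : 'I_n -> Y), (forall i, inball (ls i)) ->
    `|\sum_(i < n) ipY (f (ls i)) (ys i)| ^+ 2
      <= c%:C * \sum_(i < n) \sum_(k < n) ipY (K (ls i) (ls k) (ys k)) (ys i).

Definition in_rk (f : pt -> Y) : Prop := exists c : R, rk_bound f c.

(** squared norm in H(K) (meaningful for f in H(K)) *)
Definition rk_nsq (f : pt -> Y) : R := inf [set c | rk_bound f c].

(** inner product in H(K), by polarization *)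
Definition rk_ip (f g : pt -> Y) : C :=
  4%:R^-1 * \sum_(k < 4) 'i ^+ k * (rk_nsq (fun l => f l + 'i ^+ k *: g l))%:C.
End RKHS.

Definition kdI (Y : lmodType C) (l z : pt) (y : Y) : Y := kd l z *: y.

Section Schur.
Variables (U Y : lmodType C) (ipU : U -> U -> C) (ipY : Y -> Y -> C).

(** holomorphy on B^d of an L(U,Y)-valued function (Frechet, operator norm) *)
Definition holo (S : pt -> U -> Y) : Prop :=
  forall l0 : pt, inball l0 -> exists L : 'I_d -> U -> Y,
    (forall j, bop ipU ipY (L j)) /\
    forall e : R, 0 < e -> exists delta : R, 0 < delta /\
      forall l : pt, inball l -> complex.Re (dotC (ptsub l l0) (ptsub l l0)) < delta ->
      forall u : U,
        nsq ipY (S l u - S l0 u - \sum_(j < d) (l j - l0 j) *: L j u)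
          <= e * complex.Re (dotC (ptsub l l0) (ptsub l l0)) * nsq ipU u.

Definition mult_contr (S : pt -> U -> Y) : Prop :=
  forall f : pt -> U, in_rk ipU (@kdI U) f ->
    in_rk ipY (@kdI Y) (fun l => S l (f l)) /\
    rk_nsq ipY (@kdI Y) (fun l => S l (f l)) <= rk_nsq ipU (@kdI U) f.

Definition schur (S : pt -> U -> Y) : Prop :=
  (forall l, inball l -> bop ipU ipY (S l)) /\ holo S /\ mult_contr S.

Definition KS (S : pt -> U -> Y) (l z : pt) (y : Y) : Y :=
  kd l z *: (y - S l (adj ipU ipY (S z) y)).
End Schur.

Section Shift.
Variables (Y : lmodType C) (ipY : Y -> Y -> C).

Definition is_Mstar (j : 'I_d) (f g : pt -> Y) : Prop :=
  in_rk ipY (@kdI Y) g /\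
  forall h : pt -> Y, in_rk ipY (@kdI Y) h ->
    rk_ip ipY (@kdI Y) (fun l => l j *: h l) f = rk_ip ipY (@kdI Y) h g.

Definition Mstar (j : 'I_d) (f : pt -> Y) : pt -> Y :=
  epsilon (inhabits (fun _ => 0 : Y)) (is_Mstar j f).
End Shift.

Definition has_ccr (U Y : hilb) (S : pt -> U -> Y) : Prop :=
  exists (X : hilb) (A : 'I_d -> X -> X) (B : 'I_d -> U -> X) (Cc : X -> Y) (D : U -> Y),
    (forall j, bop (@hip X) (@hip X) (A j)) /\
    (forall j, bop (@hip U) (@hip X) (B j)) /\
    bop (@hip X) (@hip Y) Cc /\ bop (@hip U) (@hip Y) D /\
    (* contractivity of [A B; C D] : X (+) U -> X^d (+) Y *)
    (forall (x : X) (u : U),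
       \sum_(j < d) nsq (@hip X) (A j x + B j u) + nsq (@hip Y) (Cc x + D u)
         <= nsq (@hip X) x + nsq (@hip U) u) /\
    (forall i j (x : X), A i (A j x) = A j (A i x)) /\
    (* S(l) = D + C (I - Z(l)A)^{-1} Z(l) B *)
    (forall l : pt, inball l ->
       injective (fun x : X => x - \sum_(j < d) l j *: A j x) /\
       forall u : U, exists x : X,
         x - \sum_(j < d) l j *: A j x = \sum_(j < d) l j *: B j u /\
         S l u = D u + Cc x).

End Defs.

Arguments pt0 {R d} _.

(* Main.v *)
From HB Require Import structures.
Require Import Defs.
From mathcomp Require Import all_boot all_order all_algebra.
From mathcomp Require Import complex.
From mathcomp Require Import boolp classical_sets functions reals.
From mathcomp Require Import ring lra.
From Stdlib Require Import ClassicalEpsilon.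

Set Implicit Arguments.
Unset Strict Implicit.
Unset Printing Implicit Defensive.

Import Order.TTheory GRing.Theory Num.Theory.
Local Open Scope ring_scope.
Local Open Scope complex_scope.

(** Given a contractive commutative realization with colligation [V : X (+) U -> X^d (+) Y],
    factor [1 - V V^* = T T^*] through a Hilbert space [F] and append [T] to the input: the
    extended colligation is coisometric with the same commuting [A], so the kernel of the
    extended function [Sh] is [K_Sh(l, z) = G(l) G(z)^*] with [G(l) = C (1 - Z(l) A)^-1].
    Hence [H(K_Sh)] is the range of [x |-> G x] with the quotient norm.  Commutativity gives
    [M_j^* G x = G A_j x], and the inequality is [A^* A + C^* C <= 1].

    Conversely take [X = H(K_Sh)], [A_j = M_j^*], [C = ] evaluation at [0].  The Gleason identity
    [f(z) - f(0) = sum_j z_j (M_j^* f)(z)] says that [[A; C]^*] maps [(conj z_j K_z y, y)] to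
    [K_z y], and by the kernel identity [(conj z_j K_z y, y) |-> Sh(z)^* y] is isometric for the
    defect form of [[A; C]^*].  Extending this map contractively yields the adjoint of [[B; D]];
    restricting the inputs to [U] gives a realization of [S]. *)

Section ComplexNumbers.
Variable R : rcfType.
Local Notation C := R[i].
Implicit Types (a b : C) (r : R).

Lemma ReD a b : complex.Re (a + b) = complex.Re a + complex.Re b.
Proof. by case: a; case: b. Qed.

Lemma ReN a : complex.Re (- a) = - complex.Re a.
Proof. by case: a. Qed.

Lemma ReB a b : complex.Re (a - b) = complex.Re a - complex.Re b.
Proof. by rewrite ReD ReN. Qed.

Lemma ReJ a : complex.Re (conjc a) = complex.Re a.
Proof. by case: a. Qed.

Lemma Re_realM r a : complex.Re (r%:C * a) = r * complex.Re a.
Proof. by case: a => x y /=; rewrite mul0r subr0. Qed.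

Lemma Re_iM a : complex.Re ('i%C * a) = - complex.Im a.
Proof. by rewrite mulrC ReiNIm. Qed.

Lemma Re_sum (I : Type) (s : seq I) (P : pred I) (F : I -> C) :
  complex.Re (\sum_(i <- s | P i) F i) = \sum_(i <- s | P i) complex.Re (F i).
Proof. by apply: (big_morph (@complex.Re R)) => // x y; rewrite ReD. Qed.

Lemma complex_ext a b :
  complex.Re a = complex.Re b -> complex.Im a = complex.Im b -> a = b.
Proof. by move=> eqRe eqIm; apply/eqP; rewrite eq_complex eqRe eqIm !eqxx. Qed.

Lemma complex_ext_Re a b :
  complex.Re a = complex.Re b -> complex.Re ('i%C * a) = complex.Re ('i%C * b) -> a = b.
Proof. by move=> eqRe; rewrite !Re_iM => /oppr_inj; apply: complex_ext. Qed.

Definition csq a : R := complex.Re a ^+ 2 + complex.Im a ^+ 2.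

Lemma csq_ge0 a : 0 <= csq a.
Proof. by rewrite addr_ge0 // sqr_ge0. Qed.

Lemma sqr_normC_csq a : `|a| ^+ 2 = (csq a)%:C.
Proof. by rewrite -add_Re2_Im2. Qed.

Lemma mulcJ a : a * conjc a = (csq a)%:C.
Proof. by rewrite -sqr_normc sqr_normC_csq. Qed.

Lemma csqM a b : csq (a * b) = csq a * csq b.
Proof. by case: a => a1 a2; case: b => b1 b2; rewrite /csq /=; ring. Qed.

Lemma csqJ a : csq (conjc a) = csq a.
Proof. by case: a => a1 a2; rewrite /csq /= sqrrN. Qed.

Lemma csqN a : csq (- a) = csq a.
Proof. by case: a => a1 a2; rewrite /csq /= !sqrrN. Qed.

Lemma csq_real r : csq r%:C = r ^+ 2.
Proof. by rewrite /csq /= expr0n addr0. Qed.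

Lemma csq1 : csq 1 = 1.
Proof. by rewrite csq_real expr1n. Qed.

Lemma csqi : csq 'i%C = 1.
Proof. by rewrite /csq /= expr0n expr1n add0r. Qed.

Lemma sqr_Re_le a : complex.Re a ^+ 2 <= csq a.
Proof. by rewrite lerDl sqr_ge0. Qed.

Lemma csqD_young (t : R) a b : 0 < t ->
  csq (a + b) <= (1 + t) * csq a + (1 + t^-1) * csq b.
Proof.
move=> t0; have tn : t != 0 by rewrite gt_eqF.
have young (x y : R) : (x + y) ^+ 2 <= (1 + t) * x ^+ 2 + (1 + t^-1) * y ^+ 2.
  have -> : (1 + t) * x ^+ 2 + (1 + t^-1) * y ^+ 2 =
     (x + y) ^+ 2 + t * (x - t^-1 * y) ^+ 2 by field.
  by rewrite lerDl mulr_ge0 ?sqr_ge0 // ltW.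
case: a => a1 a2; case: b => b1 b2; rewrite /csq /=.
by have := young a1 b1; have := young a2 b2; lra.
Qed.

End ComplexNumbers.

Section RealInequalities.
Variable R : realFieldType.
Implicit Types a b c t : R.

Lemma amgm a b t : 0 <= a -> 0 <= b -> t ^+ 2 <= a * b -> 2 * t <= a + b.
Proof.
move=> a0 b0 h; have [t0|/ltW t0] := leP t 0; first by lra.
rewrite -(@ler_pXn2r _ 2) ?nnegrE ?addr_ge0 ?mulr_ge0 //.
by have := sqr_ge0 (a - b); nra.
Qed.

Lemma discriminant_le0 a b c :
  0 <= c -> (forall t, 0 <= a + 2 * t * b + t ^+ 2 * c) -> b ^+ 2 <= a * c.
Proof.
move=> c_ge0 poly_ge0; have [c_gt0|c_le0] := ltP 0 c.
  have := poly_ge0 (- b / c); have cn : c != 0 by rewrite gt_eqF.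
  have -> : a + 2 * (- b / c) * b + (- b / c) ^+ 2 * c = (a * c - b ^+ 2) / c by field.
  by rewrite pmulr_lge0 ?invr_gt0 // subr_ge0.
have c0 : c = 0 by apply/eqP; rewrite eq_le c_le0 c_ge0.
have [->|bn] := eqVneq b 0; first by rewrite c0 expr0n mulr0.
have := poly_ge0 (- (a + 1) / (2 * b)); rewrite c0 mulr0 addr0.
have -> : a + 2 * (- (a + 1) / (2 * b)) * b = -1 by field.
by rewrite lerNr oppr0 ler10.
Qed.

Lemma ler_of_sqr_le_mul a t : 0 <= a -> t ^+ 2 <= a * t -> t <= a.
Proof.
move=> a0; have [t0 _|t0] := leP t 0; first exact: le_trans t0 a0.
by rewrite expr2 ler_pM2r.
Qed.

Lemma ler_add_gt0_mul a b c : (forall e, 0 < e -> a <= b + e * c) -> a <= b.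
Proof.
move=> h; apply/ler_addgt0Pr => e e0; have [c0|c0] := leP c 0.
  by have := h 1 ltr01; lra.
by have := h (e / c) (divr_gt0 e0 c0); rewrite divfK // gt_eqF.
Qed.

Lemma le0_gt0_mul a c : (forall e, 0 < e -> a <= e * c) -> a <= 0.
Proof. by move=> h; apply: (@ler_add_gt0_mul _ _ c) => e /h; rewrite add0r. Qed.

End RealInequalities.

Lemma invS_small (R : archiRealFieldType) (t : R) :
  0 < t -> exists N : nat, forall n, (N <= n)%N -> n.+1%:R^-1 < t.
Proof.
move=> t0; exists (Num.truncn t^-1) => n leNn.
rewrite invf_plt ?posrE ?ltr0n //; apply: lt_le_trans (truncnS_gt _) _.
by rewrite ler_nat ltnS.
Qed.

Section LinearMaps.
Variables (K : pzRingType) (V W : lmodType K) (T : V -> W).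
Hypothesis linT : linear T.

Let linearT : {linear V -> W} := HB.pack T (GRing.isLinear.Build K V W *:%R T linT).

Lemma lin0 : T 0 = 0.
Proof. exact: (linear0 linearT). Qed.

Lemma linD x y : T (x + y) = T x + T y.
Proof. exact: (linearD linearT). Qed.

Lemma linB x y : T (x - y) = T x - T y.
Proof. exact: (linearB linearT). Qed.

Lemma linZ a x : T (a *: x) = a *: T x.
Proof. exact: (linearZ_LR linearT). Qed.

Lemma lin_sum (I : Type) (r : seq I) (P : pred I) (F : I -> V) :
  T (\sum_(i <- r | P i) F i) = \sum_(i <- r | P i) T (F i).
Proof. exact: (linear_sum linearT). Qed.

End LinearMaps.

(** * Hilbert spaces *)

Local Notation hnsq := (nsq (@hip _ _)).
Local Notation hbop := (bop (@hip _ _) (@hip _ _)).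
Local Notation hadj := (adj (@hip _ _) (@hip _ _)).

Section HilbertSpace.
Variables (R : realType) (H : hilb R).
Local Notation C := R[i].
Implicit Types (x y z : H) (a : C).

Lemma hipDl x y z : hip (x + y) z = hip x z + hip y z.
Proof. by have := hip_linl 1 x y z; rewrite scale1r mul1r. Qed.

Lemma hip0l x : hip 0 x = 0.
Proof. by apply: (addrI (hip 0 x)); rewrite -hipDl !addr0. Qed.

Lemma hipZl a x z : hip (a *: x) z = a * hip x z.
Proof. by have := hip_linl a x 0 z; rewrite !addr0 hip0l addr0. Qed.

Lemma hipNl x z : hip (- x) z = - hip x z.
Proof. by rewrite -scaleN1r hipZl mulN1r. Qed.

Lemma hipBl x y z : hip (x - y) z = hip x z - hip y z.
Proof. by rewrite hipDl hipNl. Qed.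

Lemma hipDr x y z : hip z (x + y) = hip z x + hip z y.
Proof. by rewrite hip_sym hipDl rmorphD /= -!hip_sym. Qed.

Lemma hip0r x : hip x 0 = 0.
Proof. by rewrite hip_sym hip0l conjc0. Qed.

Lemma hipZr a x z : hip z (a *: x) = conjc a * hip z x.
Proof. by rewrite hip_sym hipZl rmorphM /= -hip_sym. Qed.

Lemma hipNr x z : hip z (- x) = - hip z x.
Proof. by apply: (addrI (hip z x)); rewrite -hipDr !subrr hip0r. Qed.

Lemma hipBr x y z : hip z (x - y) = hip z x - hip z y.
Proof. by rewrite hipDr hipNr. Qed.

Lemma hip_suml (I : Type) (r : seq I) (P : pred I) (F : I -> H) z :
  hip (\sum_(i <- r | P i) F i) z = \sum_(i <- r | P i) hip (F i) z.
Proof. by apply: (big_morph (fun x => hip x z)) => [x y|]; rewrite ?hipDl ?hip0l. Qed.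

Lemma hip_sumr (I : Type) (r : seq I) (P : pred I) (F : I -> H) z :
  hip z (\sum_(i <- r | P i) F i) = \sum_(i <- r | P i) hip z (F i).
Proof. by apply: (big_morph (hip z)) => [x y|]; rewrite ?hipDr ?hip0r. Qed.

Lemma hip_ext x y : (forall z, hip z x = hip z y) -> x = y.
Proof.
move=> h; apply/eqP; rewrite -subr_eq0; apply/eqP; apply: hip_def.
by rewrite hipBr h subrr.
Qed.

Definition rip x y : R := complex.Re (hip x y).

Lemma ripC x y : rip x y = rip y x.
Proof. by rewrite /rip hip_sym ReJ. Qed.

Lemma ripDl x y z : rip (x + y) z = rip x z + rip y z.
Proof. by rewrite /rip hipDl ReD. Qed.

Lemma ripBl x y z : rip (x - y) z = rip x z - rip y z.
Proof. by rewrite /rip hipBl ReB. Qed.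

Lemma ripDr x y z : rip z (x + y) = rip z x + rip z y.
Proof. by rewrite /rip hipDr ReD. Qed.

Lemma ripBr x y z : rip z (x - y) = rip z x - rip z y.
Proof. by rewrite /rip hipBr ReB. Qed.

Lemma ripZl (r : R) x y : rip (r%:C *: x) y = r * rip x y.
Proof. by rewrite /rip hipZl Re_realM. Qed.

Lemma nsqE x : hnsq x = rip x x. Proof. by []. Qed.

Lemma nsq_ge0 x : 0 <= hnsq x.
Proof. by have := hip_pos x; rewrite lecE => /andP[_]. Qed.

Lemma hipxx x : hip x x = (hnsq x)%:C.
Proof. by apply: complex_ext => //=; apply: ger0_Im; apply: hip_pos. Qed.

Lemma nsq0 : hnsq (0 : H) = 0.
Proof. by rewrite /nsq hip0l. Qed.

Lemma nsq_le0 x : hnsq x <= 0 -> x = 0.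
Proof.
move=> h; apply: hip_def; rewrite hipxx.
by have /eqP -> : hnsq x == 0 by rewrite eq_le h nsq_ge0.
Qed.

Lemma nsqD x y : hnsq (x + y) = hnsq x + hnsq y + 2 * rip x y.
Proof. by rewrite !nsqE !ripDl !ripDr (ripC y x); lra. Qed.

Lemma nsqB x y : hnsq (x - y) = hnsq x + hnsq y - 2 * rip x y.
Proof. by rewrite !nsqE !ripBl !ripBr (ripC y x); lra. Qed.

Lemma nsqZ a x : hnsq (a *: x) = csq a * hnsq x.
Proof. by rewrite /nsq hipZl hipZr mulrA mulcJ Re_realM. Qed.

Lemma nsqN x : hnsq (- x) = hnsq x.
Proof. by rewrite -scaleN1r nsqZ csqN csq1 mul1r. Qed.

Lemma rip_CauchySchwarz x y : rip x y ^+ 2 <= hnsq x * hnsq y.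
Proof.
apply: discriminant_le0 => [|t]; first exact: nsq_ge0.
have := nsq_ge0 (x + t%:C *: y); rewrite nsqD nsqZ csq_real (ripC x) ripZl (ripC y).
by rewrite [2 * t * _]mulrAC -!mulrA (mulrC (rip x y)) addrAC.
Qed.

Lemma hip_CauchySchwarz x y : csq (hip x y) <= hnsq x * hnsq y.
Proof.
apply: ler_of_sqr_le_mul; first by rewrite mulr_ge0 ?nsq_ge0.
have := rip_CauchySchwarz x (hip x y *: y).
by rewrite nsqZ /rip hipZr mulrC mulcJ /= mulrCA mulrC -mulrA.
Qed.

Lemma nsqD_le2 x y : hnsq (x + y) <= 2 * hnsq x + 2 * hnsq y.
Proof. by have := nsq_ge0 (x - y); rewrite nsqB nsqD; lra. Qed.

Lemma nsqD_young (t : R) x y : 0 < t ->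
  hnsq (x + y) <= (1 + t^-1) * hnsq x + (1 + t) * hnsq y.
Proof.
move=> t0; rewrite nsqD; have tn : t != 0 by rewrite gt_eqF.
have := @amgm R (t^-1 * hnsq x) (t * hnsq y) (rip x y).
rewrite !mulr_ge0 ?nsq_ge0 ?invr_ge0 ?(ltW t0) //.
have -> : t^-1 * hnsq x * (t * hnsq y) = hnsq x * hnsq y by field.
by move=> /(_ isT isT (rip_CauchySchwarz x y)); lra.
Qed.

End HilbertSpace.

(* Proves linear identities in a Hilbert space by pairing with a test vector. *)
Ltac hilb_ring := apply: hip_ext => ?;
  rewrite ?(hipDr, hipBr, hipNr, hipZr, hip0r, rmorphD, rmorphM, rmorphB) /=; ring.

Section Convergence.
Variable R : realType.
Local Notation C := R[i].

Definition ip_cauchy (V : lmodType C) (ip : V -> V -> C) (u : nat -> V) : Prop :=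
  forall e : R, 0 < e -> exists N : nat, forall m n : nat, (N <= m)%N -> (N <= n)%N ->
    nsq ip (u m - u n) < e.

Definition ip_cvg (V : lmodType C) (ip : V -> V -> C) (u : nat -> V) (l : V) : Prop :=
  forall e : R, 0 < e -> exists N : nat, forall n : nat, (N <= n)%N -> nsq ip (u n - l) < e.

Variable H : hilb R.

Lemma cauchy_ip_cvg (u : nat -> H) :
  ip_cauchy (@hip R H) u -> exists l, ip_cvg (@hip R H) u l.
Proof. exact: hip_complete. Qed.

Lemma ip_cvg_approx_point (P : R -> H -> Prop) :
  (forall e e' x, e <= e' -> P e x -> P e' x) ->
  (forall e, 0 < e -> exists x, P e x) ->
  (forall e e' x y, P e x -> P e' y -> hnsq (x - y) <= 2 * e + 2 * e') ->
  exists h, forall e, 0 < e -> exists2 x, P e x & hnsq (x - h) < e.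
Proof.
move=> P_mono P_ex P_diam.
have /boolp.choice[x Px] (n : nat) : exists x, P n.+1%:R^-1 x by apply: P_ex; rewrite invr_gt0.
have [|h x_h] := @cauchy_ip_cvg x.
  move=> e e0; have [N ltN] := @invS_small R (e / 4) ltac:(lra).
  exists N => m n Nm Nn; apply: le_lt_trans (P_diam _ _ _ _ (Px m) (Px n)) _.
  have := ltN _ Nm; have := ltN _ Nn.
  by move: (n.+1%:R^-1 : R) (m.+1%:R^-1 : R) => ? ?; lra.
exists h => e e0; have [N ltN] := invS_small e0; have [N' x_near] := x_h e e0.
exists (x (N + N')%N); last by apply: x_near; rewrite leq_addl.
by apply: P_mono (Px _); rewrite ltW // ltN // leq_addr.
Qed.

End Convergence.

(** * Riesz representation and adjoints *)

Section LinearCombinations.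
Variables (K : pzRingType) (V : lmodType K) (I : Type) (a : I -> V).
Implicit Types s t : seq (K * I).

Definition lincomb s : V := \sum_(p <- s) p.1 *: a p.2.

Definition scale_coefs (c : K) s : seq (K * I) := [seq (c * p.1, p.2) | p <- s].

Lemma lincomb_cat s t : lincomb (s ++ t) = lincomb s + lincomb t.
Proof. exact: big_cat. Qed.

Lemma lincomb_scale c s : lincomb (scale_coefs c s) = c *: lincomb s.
Proof. by rewrite /lincomb big_map scaler_sumr; apply: eq_bigr => p _; rewrite scalerA. Qed.

Lemma lincomb1 i : lincomb [:: (1, i)] = a i.
Proof. by rewrite /lincomb big_seq1 scale1r. Qed.

End LinearCombinations.

Lemma lin_lincomb (K : pzRingType) (V W : lmodType K) (T : V -> W) (I : Type) (a : I -> V) s :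
  linear T -> T (lincomb a s) = lincomb (T \o a) s.
Proof.
by move=> linT; rewrite (lin_sum linT); apply: eq_bigr => p _; rewrite (linZ linT).
Qed.

Section RieszRepresentation.
Variables (R : realType) (H : hilb R) (I : Type) (a : I -> H).
Local Notation C := R[i].
Implicit Types s t : seq (C * I).

Lemma hip_lincombl s h : hip (lincomb a s) h = lincomb (fun i => hip (a i) h : C^o) s.
Proof. by rewrite hip_suml; apply: eq_bigr => p _; rewrite hipZl. Qed.

Definition in_closed_span (h : H) : Prop :=
  forall e : R, 0 < e -> exists s, hnsq (lincomb a s - h) < e.

Lemma in_closed_span_linear (c : C) h h' :
  in_closed_span h -> in_closed_span h' -> in_closed_span (c *: h + h').
Proof.
move=> span_h span_h' e e0; pose q := 2 * csq c + 2.
have q0 : 0 < q by rewrite /q; have := csq_ge0 c; lra.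
have eq0 : 0 < e / q by rewrite divr_gt0.
have [s near_h] := span_h _ eq0; have [t near_h'] := span_h' _ eq0.
exists (scale_coefs c s ++ t); rewrite lincomb_cat lincomb_scale opprD addrACA -scalerBr.
apply: le_lt_trans (nsqD_le2 _ _) _; rewrite nsqZ.
have : csq c * hnsq (lincomb a s - h) <= csq c * (e / q).
  by apply: ler_wpM2l; [exact: csq_ge0 | exact: ltW].
have : q * (e / q) = e by rewrite mulrC divfK // gt_eqF.
by rewrite /q; move: near_h'; lra.
Qed.

Lemma in_closed_span_orthogonal_eq0 h :
  in_closed_span h -> (forall i, hip (a i) h = 0) -> h = 0.
Proof.
move=> span_h orth; apply: nsq_le0; apply: (@le0_gt0_mul _ _ 1) => e e0; rewrite mulr1.
have [s /ltW near_h] := span_h e e0; apply: le_trans near_h.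
have orth_s : hip (lincomb a s) h = 0.
  by rewrite hip_lincombl; apply: big1 => p _; rewrite orth scaler0.
by rewrite nsqB /rip orth_s mulr0 subr0 lerDr nsq_ge0.
Qed.

Variables (phi : I -> C^o) (K : R).
Hypothesis K_ge0 : 0 <= K.
Hypothesis phi_bounded : forall s, csq (lincomb phi s) <= K * hnsq (lincomb a s).

Let energy s : R := hnsq (lincomb a s) - 2 * complex.Re (lincomb phi s).

Let energy_ge s : - K <= energy s.
Proof.
rewrite /energy; have := @amgm R K (hnsq (lincomb a s)) (complex.Re (lincomb phi s)).
rewrite nsq_ge0 K_ge0 (le_trans (sqr_Re_le _) (phi_bounded s)) => /(_ isT isT isT).
by lra.
Qed.

Let min_energy : R := inf (range energy).

Let energy_has_inf : has_inf (range energy).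
Proof.
split; first by exists (energy [::]), [::].
by exists (- K) => _ [s _ <-]; exact: energy_ge.
Qed.

Let min_energy_le s : min_energy <= energy s.
Proof. by apply: ge_inf; [exact: energy_has_inf.2 | exists s]. Qed.

Let min_energy_ge : - K <= min_energy.
Proof. by apply: lb_le_inf; [exact: energy_has_inf.1 | move=> _ [s _ <-]; exact: energy_ge]. Qed.

Let energy_parallelogram s t : hnsq (lincomb a s - lincomb a t) <=
  2 * (energy s - min_energy) + 2 * (energy t - min_energy).
Proof.
have := min_energy_le (scale_coefs (2^-1)%:C (s ++ t)).
rewrite /energy !lincomb_scale !lincomb_cat nsqZ csq_real Re_realM ReD nsqB nsqD.
by lra.
Qed.

Let energy_minimizer : exists h, forall e, 0 < e ->
  exists2 s, energy s < min_energy + e & hnsq (lincomb a s - h) < e.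
Proof.
pose P e x := exists2 s, energy s < min_energy + e & x = lincomb a s.
have [e e' x le_e [s lt_s xE]|e e0|e e' x y [s lt_s ->] [t lt_t ->]|h near_h] :=
  @ip_cvg_approx_point R H P.
- by exists s => //; apply: lt_le_trans lt_s _; rewrite lerD2l.
- have [_ [s _ <-] lt_s] := inf_adherent e0 energy_has_inf.
  by exists (lincomb a s), s.
- by apply: le_trans (energy_parallelogram s t) _; lra.
by exists h => e e0; have [_ [s lt_s ->] lt_h] := near_h e e0; exists s.
Qed.

(* First variation: moving by [r *: lincomb a t] cannot bring the energy below its infimum. *)
Let energy_variation s t e : energy s < min_energy + e ->
  (rip (lincomb a s) (lincomb a t) - complex.Re (lincomb phi t)) ^+ 2 <= e * hnsq (lincomb a t).
Proof.
move=> lt_s; apply: discriminant_le0 => [|r]; first exact: nsq_ge0.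
have := min_energy_le (s ++ scale_coefs r%:C t).
rewrite /energy !lincomb_cat !lincomb_scale nsqD nsqZ csq_real ReD Re_realM ripC ripZl ripC.
by move: lt_s; rewrite /energy; lra.
Qed.

Lemma riesz_closed_span : exists h : H,
  [/\ forall i, hip (a i) h = phi i, in_closed_span h & hnsq h <= K].
Proof.
have [h near_h] := energy_minimizer; exists h.
have rip_h t : rip (lincomb a t) h = complex.Re (lincomb phi t).
  apply/eqP; rewrite -subr_eq0 -sqrf_eq0 eq_le sqr_ge0 andbT.
  apply: (@le0_gt0_mul _ _ (4 * hnsq (lincomb a t))) => e e0.
  have [s /(energy_variation t) var_s near_s] := near_h e e0.
  have : rip (lincomb a s - h) (lincomb a t) ^+ 2 <= e * hnsq (lincomb a t).
    by apply: le_trans (rip_CauchySchwarz _ _) _; apply: ler_wpM2r; rewrite ?nsq_ge0 // ltW.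
  move: var_s; rewrite ripBl (ripC h).
  move: (rip (lincomb a s) _) (rip _ h) (complex.Re _) => x y z x_z x_y.
  by have := sqr_ge0 ((x - z) + (x - y)); nra.
split=> [i|e e0|].
- apply: complex_ext_Re; first by rewrite -(lincomb1 phi) -rip_h lincomb1.
  have := rip_h [:: ('i%C, i)]; rewrite /rip hip_lincombl /lincomb !big_seq1.
  exact.
- by have [s _ near_s] := near_h e e0; exists s.
apply: (@ler_add_gt0_mul _ _ _ 1) => e e0; have [s lt_s] := near_h e e0.
have := min_energy_le s; have := min_energy_ge.
by rewrite /energy nsqB rip_h; lra.
Qed.

End RieszRepresentation.

Definition contraction (R : realType) (H H' : hilb R) (T : H -> H') : Prop :=
  linear T /\ forall x, hnsq (T x) <= hnsq x.

Section FamilyAdjoint.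
Variables (R : realType) (H H' : hilb R) (I : Type) (a : I -> H) (b : I -> H').
Local Notation C := R[i].

(* If [a i |-> b i] extends to a bounded operator on the span of [a], [T] is the adjoint of
   its extension by zero. *)
Lemma bounded_family_adjoint (M : R) : 0 <= M ->
  (forall s : seq (C * I), hnsq (lincomb b s) <= M * hnsq (lincomb a s)) ->
  exists T : H' -> H, [/\ linear T, forall i u, hip (a i) (T u) = hip (b i) u
    & forall u, hnsq (T u) <= M * hnsq u].
Proof.
move=> M0 b_le_a.
have /boolp.choice[T TP] (u : H') : exists h : H, [/\ forall i, hip (a i) h = hip (b i) u,
    in_closed_span a h & hnsq h <= M * hnsq u].
  apply: riesz_closed_span => [|s]; first by rewrite mulr_ge0 ?nsq_ge0.
  rewrite -hip_lincombl mulrAC; apply: le_trans (hip_CauchySchwarz _ _) _.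
  by apply: ler_wpM2r; first exact: nsq_ge0.
exists T; split=> [c x y|i u|u]; [|by have [-> _ _] := TP u | by have [_ _] := TP u].
have [Tx span_x _] := TP x; have [Ty span_y _] := TP y.
have [Txy span_xy _] := TP (c *: x + y).
suff : -1 *: (c *: T x + T y) + T (c *: x + y) = 0.
  by move/eqP; rewrite scaleN1r [- _ + _]addrC subr_eq0 => /eqP.
apply: (in_closed_span_orthogonal_eq0 (a := a)).
  exact: in_closed_span_linear (in_closed_span_linear c span_x span_y) span_xy.
by move=> i; rewrite !(hipDr, hipZr) Tx Ty Txy hipDr hipZr rmorphN1 mulN1r addNr.
Qed.

Lemma lurking_isometry : (forall i k, hip (b i) (b k) = hip (a i) (a k)) ->
  exists T : H' -> H, contraction T /\ forall i u, hip (a i) (T u) = hip (b i) u.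
Proof.
move=> gram; have [s|T [T_lin T_adj T_le]] := @bounded_family_adjoint 1 ler01.
  rewrite mul1r le_eqVlt; apply/orP; left; apply/eqP; congr complex.Re.
  rewrite !hip_sumr; apply: eq_bigr => p _; rewrite !hip_suml; apply: eq_bigr => p' _.
  by rewrite !hipZl !hipZr gram.
by exists T; split=> //; split=> // x; rewrite -[leRHS]mul1r.
Qed.

End FamilyAdjoint.

Section Adjoint.
Variables (R : realType) (V W : hilb R) (T : V -> W).

Lemma bop_ge0 : hbop T -> exists2 M, 0 <= M & forall x, hnsq (T x) <= M * hnsq x.
Proof.
move=> [_ [M T_le]]; exists `|M| => [|x]; first exact: normr_ge0.
by apply: le_trans (T_le x) _; apply: ler_wpM2r; rewrite ?nsq_ge0 ?ler_norm.
Qed.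

Let adjoint_exists M : linear T -> 0 <= M -> (forall x, hnsq (T x) <= M * hnsq x) ->
  exists Ts : W -> V, [/\ linear Ts, forall x w, hip x (Ts w) = hip (T x) w
    & forall w, hnsq (Ts w) <= M * hnsq w].
Proof.
move=> linT M0 T_le; apply: (bounded_family_adjoint M0) => s.
by rewrite -[T]/(T \o id) -lin_lincomb.
Qed.

Hypothesis bT : hbop T.

Lemma adjP x w : hip (T x) w = hip x (hadj T w).
Proof.
have [M M0 T_le] := bop_ge0 bT; have [Ts [_ TsP _]] := adjoint_exists bT.1 M0 T_le.
apply: (epsilon_spec (inhabits (0 : V)) (fun v => forall x, hip (T x) w = hip x v)).
by exists (Ts w).
Qed.

Lemma adjP_sym x w : hip w (T x) = hip (hadj T w) x.
Proof. by rewrite hip_sym adjP -hip_sym. Qed.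

Lemma adj_unique w v : (forall x, hip (T x) w = hip x v) -> hadj T w = v.
Proof. by move=> vP; apply: hip_ext => x; rewrite -adjP. Qed.

Lemma adj_linear : linear (hadj T).
Proof. by move=> a x y; apply: hip_ext => z; rewrite -adjP !(hipDr, hipZr) -!adjP. Qed.

Lemma adj_bound M : 0 <= M -> (forall x, hnsq (T x) <= M * hnsq x) ->
  forall w, hnsq (hadj T w) <= M * hnsq w.
Proof.
move=> M0 T_le w; have [Ts [_ TsP Ts_le]] := adjoint_exists bT.1 M0 T_le.
by rewrite (adj_unique (v := Ts w)).
Qed.

Lemma bop_adj : hbop (hadj T).
Proof.
split; first exact: adj_linear.
by have [M M0 T_le] := bop_ge0 bT; exists M => w; apply: adj_bound.
Qed.

End Adjoint.

Section BoundedOperators.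
Variable R : realType.
Local Notation C := R[i].
Implicit Types V W X : hilb R.

Lemma bopD V W (T T' : V -> W) : hbop T -> hbop T' -> hbop (fun x => T x + T' x).
Proof.
move=> [linT [M T_le]] [linT' [M' T'_le]]; split.
  by move=> a x y; rewrite linT linT'; hilb_ring.
exists (2 * M + 2 * M') => x; apply: le_trans (nsqD_le2 _ _) _.
by have := T_le x; have := T'_le x; lra.
Qed.

Lemma bopZ V W (T : V -> W) (a : C) : hbop T -> hbop (fun x => a *: T x).
Proof.
move=> [linT [M T_le]]; split; first by move=> b x y; rewrite linT; hilb_ring.
by exists (csq a * M) => x; rewrite nsqZ -mulrA; apply: ler_wpM2l; first exact: csq_ge0.
Qed.

Lemma bop_sum V W (I : Type) (r : seq I) (T : I -> V -> W) :
  (forall i, hbop (T i)) -> hbop (fun x => \sum_(i <- r) T i x).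
Proof.
move=> bT; elim: r => [|i r IHr].
  split=> [a x y|]; first by rewrite !big_nil scaler0 addr0.
  by exists 0 => x; rewrite big_nil nsq0 mul0r.
under [fun x => _]eq_fun do rewrite big_cons.
exact: bopD.
Qed.

Lemma bop_comp V W X (T : V -> W) (T' : W -> X) :
  hbop T -> hbop T' -> hbop (fun x => T' (T x)).
Proof.
move=> [linT [M T_le]] bT'; have [M' M'0 T'_le] := bop_ge0 bT'.
split=> [a x y|]; first by rewrite linT bT'.1.
by exists (M' * M) => x; apply: le_trans (T'_le _) _; rewrite -mulrA; apply: ler_wpM2l.
Qed.

Lemma contraction_bop V W (T : V -> W) : contraction T -> hbop T.
Proof. by move=> [linT T_le]; split=> //; exists 1 => x; rewrite mul1r. Qed.

Lemma contraction_adj V W (T : V -> W) : contraction T -> contraction (hadj T).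
Proof.
move=> contrT; have bT := contraction_bop contrT; split; first exact: adj_linear.
by move=> w; rewrite -[leRHS]mul1r; apply: adj_bound => // x; rewrite mul1r contrT.2.
Qed.

Lemma coisometry_contraction V W (T : V -> W) : hbop T ->
  (forall w w', hip (hadj T w) (hadj T w') = hip w w') -> contraction T.
Proof.
move=> bT coiso; split=> [|x]; first exact: bT.1.
apply: ler_of_sqr_le_mul; first exact: nsq_ge0.
have := rip_CauchySchwarz x (hadj T (T x)).
by rewrite {1}/rip -adjP // /nsq coiso.
Qed.

End BoundedOperators.

(** * Direct sums *)

Section ProductSpace.
Variables (R : realType) (U F : hilb R).
Local Notation C := R[i].
Local Notation ip := (ipsum (@hip R U) (@hip R F)).
Implicit Types p q : (U * F)%type.

Let ipsum_lin (a : C) p q z : ip (a *: p + q) z = a * ip p z + ip q z.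
Proof. by rewrite /ipsum /= !hipDl !hipZl; ring. Qed.

Let ipsum_sym p q : ip q p = conjc (ip p q).
Proof. by rewrite /ipsum rmorphD /= -!hip_sym. Qed.

Let ipsum_pos p : 0 <= ip p p.
Proof. by rewrite addr_ge0 // hip_pos. Qed.

Let ipsum_def p : ip p p = 0 -> p = 0.
Proof.
move/eqP; rewrite /ipsum paddr_eq0 ?hip_pos // => /andP[/eqP p1 /eqP p2].
by case: p p1 p2 => p1 p2 /= /hip_def -> /hip_def ->.
Qed.

Let nsq_ipsum p : nsq ip p = hnsq p.1 + hnsq p.2.
Proof. by rewrite /nsq ReD. Qed.

Let ipsum_complete (u : nat -> U * F) : ip_cauchy ip u -> exists l, ip_cvg ip u l.
Proof.
move=> cauchy_u.
have [|l1 cvg1] := @cauchy_ip_cvg R U (fun n => (u n).1).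
  move=> e /cauchy_u[N uN]; exists N => m n Nm Nn; apply: le_lt_trans (uN m n Nm Nn).
  by rewrite nsq_ipsum lerDl nsq_ge0.
have [|l2 cvg2] := @cauchy_ip_cvg R F (fun n => (u n).2).
  move=> e /cauchy_u[N uN]; exists N => m n Nm Nn; apply: le_lt_trans (uN m n Nm Nn).
  by rewrite nsq_ipsum lerDr nsq_ge0.
exists (l1, l2) => e e0.
have [N1 uN1] := cvg1 (e / 2) ltac:(lra); have [N2 uN2] := cvg2 (e / 2) ltac:(lra).
exists (N1 + N2)%N => n Nn; rewrite nsq_ipsum /=.
have := uN1 n (leq_trans (leq_addr _ _) Nn); have := uN2 n (leq_trans (leq_addl _ _) Nn).
by lra.
Qed.

Definition hprod : hilb R := Hilb ipsum_lin ipsum_sym ipsum_pos ipsum_def ipsum_complete.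

Lemma hip_prod (p q : hprod) : hip p q = hip p.1 q.1 + hip p.2 q.2.
Proof. by []. Qed.

Lemma nsq_prod (p : hprod) : hnsq p = hnsq p.1 + hnsq p.2.
Proof. exact: nsq_ipsum. Qed.

Lemma contraction_fst : contraction (fun p : hprod => p.1).
Proof. by split=> // p; rewrite nsq_prod lerDl nsq_ge0. Qed.

Lemma contraction_snd : contraction (fun p : hprod => p.2).
Proof. by split=> // p; rewrite nsq_prod lerDr nsq_ge0. Qed.

Lemma contraction_inl : contraction (fun u : U => (u, 0) : hprod).
Proof.
split=> [a x y|u]; last by rewrite nsq_prod /= nsq0 addr0.
by apply: injective_projections => //=; rewrite scaler0 addr0.
Qed.

Lemma contraction_inr : contraction (fun f : F => (0, f) : hprod).
Proof.
split=> [a x y|f]; last by rewrite nsq_prod /= nsq0 add0r.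
by apply: injective_projections => //=; rewrite scaler0 addr0.
Qed.

End ProductSpace.

Section PowerSpace.
Variables (R : realType) (d : nat) (X : hilb R).
Local Notation C := R[i].
Local Notation pow := {ffun 'I_d -> X}.
Implicit Types f g : pow.

Definition ippow f g : C := \sum_(j < d) hip (f j) (g j).

Let ippow_lin (a : C) f g h : ippow (a *: f + g) h = a * ippow f h + ippow g h.
Proof.
rewrite /ippow mulr_sumr -big_split /=; apply: eq_bigr => j _.
by rewrite !ffunE hipDl hipZl.
Qed.

Let ippow_sym f g : ippow g f = conjc (ippow f g).
Proof. by rewrite /ippow rmorph_sum /=; apply: eq_bigr => j _; rewrite -hip_sym. Qed.

Let ippow_pos f : 0 <= ippow f f.
Proof. by apply: sumr_ge0 => j _; apply: hip_pos. Qed.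

Let ippow_def f : ippow f f = 0 -> f = 0.
Proof.
move=> f0; apply/ffunP => j; rewrite ffunE; apply: hip_def.
by apply: (@psumr_eq0P _ _ predT (fun j => hip (f j) (f j))) => // i _; apply: hip_pos.
Qed.

Let nsq_ippow f : nsq ippow f = \sum_(j < d) hnsq (f j).
Proof. by rewrite /nsq Re_sum. Qed.

Let nsq_ippow_ge f j : hnsq (f j) <= nsq ippow f.
Proof. by rewrite nsq_ippow (bigD1 j) //= lerDl sumr_ge0 // => i _; apply: nsq_ge0. Qed.

Let ippow_complete (u : nat -> pow) : ip_cauchy ippow u -> exists l, ip_cvg ippow u l.
Proof.
move=> cauchy_u.
have /boolp.choice[l cvg_l] j : exists l : X, ip_cvg (@hip R X) (fun n => u n j) l.
  apply: cauchy_ip_cvg => e /cauchy_u[N uN]; exists N => m n Nm Nn.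
  by apply: le_lt_trans (uN m n Nm Nn); have := nsq_ippow_ge (u m - u n) j; rewrite !ffunE.
exists [ffun j => l j] => e e0.
have e_d0 : 0 < e / d.+1%:R by rewrite divr_gt0 // ltr0n.
have /boolp.choice[N uN] j := cvg_l j _ e_d0.
exists (\max_j N j) => n Nn; rewrite nsq_ippow.
apply: (@le_lt_trans _ _ (\sum_(j < d) e / d.+1%:R)).
  apply: ler_sum => j _; rewrite !ffunE ltW // uN //.
  exact: leq_trans (leq_bigmax j) Nn.
rewrite sumr_const card_ord -[ltLHS]mulr_natr mulrAC ltr_pdivrMr ?ltr0n //.
by rewrite ltr_pM2l // ltr_nat.
Qed.

Definition hpow : hilb R := Hilb ippow_lin ippow_sym ippow_pos ippow_def ippow_complete.

Lemma hip_pow (f g : hpow) : hip f g = \sum_(j < d) hip (f j) (g j).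
Proof. by []. Qed.

Lemma nsq_pow (f : hpow) : hnsq f = \sum_(j < d) hnsq (f j).
Proof. exact: nsq_ippow. Qed.

Lemma contraction_coord j : contraction (fun f : hpow => f j).
Proof. by split=> [a f g|f]; [rewrite !ffunE | exact: nsq_ippow_ge]. Qed.

Lemma nsq_sumZ_le (l : 'I_d -> C) (w : 'I_d -> X) :
  hnsq (\sum_(j < d) l j *: w j) <= (\sum_(j < d) csq (l j)) * \sum_(j < d) hnsq (w j).
Proof.
set x := \sum_(j < d) _.
pose f : hpow := [ffun j => w j]; pose g : hpow := [ffun j => conjc (l j) *: x].
have rip_fg : rip f g = hnsq x.
  rewrite nsqE {2}/x /rip hip_suml hip_pow; congr complex.Re.
  by apply: eq_bigr => j _; rewrite !ffunE hipZl hipZr conjcK.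
have nsq_f : hnsq f = \sum_(j < d) hnsq (w j).
  by rewrite nsq_pow; apply: eq_bigr => j _; rewrite ffunE.
have nsq_g : hnsq g = (\sum_(j < d) csq (l j)) * hnsq x.
  by rewrite nsq_pow mulr_suml; apply: eq_bigr => j _; rewrite ffunE nsqZ csqJ.
apply: ler_of_sqr_le_mul.
  by rewrite mulr_ge0 // sumr_ge0 // => j _; rewrite ?csq_ge0 ?nsq_ge0.
by rewrite mulrAC mulrC -nsq_f -nsq_g -rip_fg rip_CauchySchwarz.
Qed.

End PowerSpace.

(* Telescoping over [n] equal steps costs [n ^ 2 * (1 / n) ^ 4]. *)
Lemma flat_path_constant (R : realType) (X : hilb R) (v : R -> X) (K : R) :
  (forall s t, 0 <= s <= 1 -> 0 <= t <= 1 -> hnsq (v t - v s) <= (t - s) ^+ 2 ^+ 2 * K) ->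
  v 1 = v 0.
Proof.
move=> flat_v.
have K0 : 0 <= K.
  have := flat_v 0 1; rewrite subr0 !expr1n mul1r !ler01 !lexx => /(_ isT isT).
  by apply: le_trans; exact: nsq_ge0.
have le_inv (n : nat) : hnsq (v 1 - v 0) <= n.+1%:R^-1 * K.
  pose s (m : nat) : R := m%:R / n.+1%:R.
  have s01 (m : nat) : (m <= n.+1)%N -> 0 <= s m <= 1.
    by move=> mn; rewrite divr_ge0 ?ler0n //= ler_pdivrMr ?ltr0n // mul1r ler_nat.
  have -> : v 1 - v 0 = \sum_(m < n.+1) (1 : R[i]) *: (v (s m.+1) - v (s m)).
    under eq_bigr do rewrite scale1r.
    rewrite -(big_mkord predT (fun m => v (s m.+1) - v (s m))) telescope_sumr //.
    by rewrite /s mul0r divff ?pnatr_eq0.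
  apply: le_trans (nsq_sumZ_le _ _) _; rewrite sumr_const card_ord csq1.
  apply: (@le_trans _ _ (n.+1%:R * \sum_(m < n.+1) n.+1%:R^-1 ^+ 2 ^+ 2 * K)).
    apply: ler_wpM2l; rewrite ?ler0n //; apply: ler_sum => m _.
    have -> : n.+1%:R^-1 = s m.+1 - s m by rewrite /s -mulrBl -natrB // subSnn mul1r.
    by apply: flat_v; apply: s01; rewrite // ltnW.
  rewrite sumr_const card_ord -[X in _ * X <= _]mulr_natl.
  have q0 : n.+1%:R != 0 :> R by rewrite pnatr_eq0.
  have q1 : n.+1%:R^-1 <= 1 :> R by rewrite invf_le1 ?ltr0n // ler1n.
  have -> : n.+1%:R * (n.+1%:R * (n.+1%:R^-1 ^+ 2 ^+ 2 * K)) =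
      n.+1%:R^-1 * (n.+1%:R^-1 * K) :> R.
    by move: (n.+1%:R : R) q0 {q1} => q q0; field.
  by apply: ler_wpM2l; rewrite ?invr_ge0 ?ler0n // ler_piMl.
apply/eqP; rewrite -subr_eq0; apply/eqP; apply: nsq_le0; apply: (@le0_gt0_mul _ _ K) => e.
move=> /invS_small[N /(_ N (leqnn N)) ltN]; apply: le_trans (le_inv N) _.
by apply: ler_wpM2r => //; exact: ltW.
Qed.

(** * Row operators, resolvents and observability *)

Section Points.
Variables (R : realType) (d : nat).
Local Notation C := R[i].
Implicit Types l z : pt R d.

Definition psq l : R := \sum_(j < d) csq (l j).

Definition ptadd l z : pt R d := fun j => l j + z j.

Definition ptscale (a : C) l : pt R d := fun j => a * l j.

Definition ptdelta (j : 'I_d) (a : C) : pt R d := fun i => if i == j then a else 0.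

Lemma dotCE l z : dotC l z = \sum_(j < d) l j * conjc (z j).
Proof. by []. Qed.

Lemma Re_dotCxx l : complex.Re (dotC l l) = psq l.
Proof. by rewrite dotCE Re_sum; apply: eq_bigr => j _; rewrite mulcJ. Qed.

Lemma inballE l : inball l <-> psq l < 1.
Proof. by rewrite /inball Re_dotCxx. Qed.

Lemma psq_ge0 l : 0 <= psq l.
Proof. by apply: sumr_ge0 => j _; apply: csq_ge0. Qed.

Lemma inball0 : inball (pt0 : pt R d).
Proof. by apply/inballE; rewrite /psq big1 // => j _; rewrite csq_real expr0n. Qed.

Lemma psq_scale a l : psq (ptscale a l) = csq a * psq l.
Proof. by rewrite /psq mulr_sumr; apply: eq_bigr => j _; rewrite csqM. Qed.

Lemma psq_delta j a : psq (ptdelta j a) = csq a.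
Proof.
rewrite /psq (bigD1 j) //= /ptdelta eqxx big1 ?addr0 // => i /negbTE ->.
by rewrite csq_real expr0n.
Qed.

Lemma ptsubKC l z : ptadd l (ptsub z l) = z.
Proof. by apply/funext => j; rewrite /ptadd /ptsub addrC subrK. Qed.

Lemma psqD_young (t : R) l z : 0 < t ->
  psq (ptadd l z) <= (1 + t) * psq l + (1 + t^-1) * psq z.
Proof.
move=> t0; rewrite /psq !mulr_sumr -big_split /=; apply: ler_sum => j _.
exact: csqD_young.
Qed.

Lemma psqD_le_mid (rho eps : R) l z : psq l <= rho -> rho < 1 -> 0 < eps ->
  eps <= (1 - rho) / 6 -> psq z <= eps ^+ 2 -> psq (ptadd l z) <= (1 + rho) / 2.
Proof.
move=> l_rho rho1 eps0 eps_le z_eps; apply: le_trans (psqD_young _ _ eps0) _.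
have l0 := psq_ge0 l.
have z_le : eps^-1 * psq z <= eps by rewrite mulrC ler_pdivrMr // -expr2.
have l_le : eps * psq l <= eps * 1 by apply: ler_wpM2l; lra.
have eps2_le : eps ^+ 2 <= eps * 1 by rewrite expr2; apply: ler_wpM2l; lra.
by lra.
Qed.

End Points.

Section RowOperator.
Variables (R : realType) (d : nat) (V X : hilb R) (A : 'I_d -> V -> X).
Local Notation C := R[i].
Implicit Types l z : pt R d.

(* [Z(l) A] in the notation of the paper. *)
Definition rowop l x : X := \sum_(j < d) l j *: A j x.

Lemma rowop_sub l z x : rowop (ptsub l z) x = rowop l x - rowop z x.
Proof. by rewrite /rowop -sumrB; apply: eq_bigr => j _; rewrite scalerBl. Qed.

Lemma rowop_scale (a : C) l x : rowop (ptscale a l) x = a *: rowop l x.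
Proof. by rewrite /rowop scaler_sumr; apply: eq_bigr => j _; rewrite scalerA. Qed.

Lemma rowop_delta j (a : C) x : rowop (ptdelta j a) x = a *: A j x.
Proof.
rewrite /rowop (bigD1 j) //= /ptdelta eqxx big1 ?addr0 // => i /negbTE ->.
by rewrite scale0r.
Qed.

Lemma rowop0 x : rowop pt0 x = 0.
Proof. by apply: big1 => j _; rewrite scale0r. Qed.

Lemma rowop_linear l : (forall j, linear (A j)) -> linear (rowop l).
Proof.
move=> linA a x y; rewrite /rowop scaler_sumr -big_split /=; apply: eq_bigr => j _.
by rewrite linA scalerDr !scalerA mulrC.
Qed.

Lemma rowop_bop l : (forall j, hbop (A j)) -> hbop (rowop l).
Proof. by move=> bA; apply: bop_sum => j; apply: bopZ. Qed.

End RowOperator.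

Definition column_contraction (R : realType) (d : nat) (X : hilb R)
    (A : 'I_d -> X -> X) : Prop :=
  (forall j, linear (A j)) /\ forall x, \sum_(j < d) hnsq (A j x) <= hnsq x.

Lemma column_contraction_bop (R : realType) (d : nat) (X : hilb R) (A : 'I_d -> X -> X) j :
  column_contraction A -> hbop (A j).
Proof.
move=> [linA A_le]; split; first exact: linA.
exists 1 => x; rewrite mul1r; apply: le_trans (A_le x).
by rewrite (bigD1 j) //= lerDl; apply: sumr_ge0 => i _; apply: nsq_ge0.
Qed.

Section Resolvent.
Variables (R : realType) (d : nat) (X : hilb R) (A : 'I_d -> X -> X).
Local Notation C := R[i].
Hypothesis contrA : column_contraction A.
Implicit Types (l z : pt R d) (x y : X).

Let rowA_linear l : linear (rowop A l).
Proof. exact: rowop_linear contrA.1. Qed.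

Lemma nsq_rowop l x : hnsq (rowop A l x) <= psq l * hnsq x.
Proof.
by apply: le_trans (nsq_sumZ_le _ _) _; apply: ler_wpM2l; rewrite ?psq_ge0 ?contrA.2.
Qed.

Definition res_const (rho : R) : R := 6 / (1 - rho) ^+ 2.

Lemma res_const_ge0 rho : 0 <= res_const rho.
Proof. by rewrite divr_ge0 ?sqr_ge0. Qed.

Lemma res_const_le rho rho' : rho <= rho' -> rho' < 1 -> res_const rho <= res_const rho'.
Proof.
move=> le_rho rho'1; have [rho_gt0 rho'_gt0] : 0 < 1 - rho /\ 0 < 1 - rho' by lra.
rewrite /res_const ler_wpM2l // lef_pV2 ?posrE ?exprn_gt0 //.
by apply: lerXn2r; rewrite ?nnegrE; lra.
Qed.

Lemma nsq_le_sub_contraction (E : X -> X) (rho : R) : 0 <= rho -> rho < 1 ->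
  (forall x, hnsq (E x) <= rho * hnsq x) ->
  forall x, hnsq x <= res_const rho * hnsq (x - E x).
Proof.
move=> rho0 rho1 E_le x; pose t := (1 - rho) / 2; have t0 : 0 < t by rewrite /t; lra.
have := nsqD_young (x - E x) (E x) t0; rewrite subrK => young.
have tE_le : (1 + t) * hnsq (E x) <= (1 - t) * hnsq x.
  apply: le_trans (ler_wpM2l _ (E_le x)) _; first by lra.
  by rewrite mulrA; apply: ler_wpM2r; [exact: nsq_ge0 | rewrite /t; nra].
have le_t : t * hnsq x <= (1 + t^-1) * hnsq (x - E x) by lra.
rewrite -(ler_pM2l t0); apply: le_trans le_t _; rewrite mulrA; apply: ler_wpM2r.
  exact: nsq_ge0.
have n1 : 1 - rho != 0 by rewrite gt_eqF; lra.
have -> : t * res_const rho = 3 / (1 - rho) by rewrite /t /res_const; field.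
have -> : 1 + t^-1 = (3 - rho) / (1 - rho) by rewrite /t; field.
by rewrite ler_pM2r ?invr_gt0; lra.
Qed.

Definition pencil l x : X := x - rowop A l x.

Lemma pencil_linear l : linear (pencil l).
Proof. by move=> a x y; rewrite /pencil rowA_linear; hilb_ring. Qed.

Lemma nsq_le_pencil l x : inball l -> hnsq x <= res_const (psq l) * hnsq (pencil l x).
Proof.
move=> /inballE l1; apply: nsq_le_sub_contraction => //; first exact: psq_ge0.
exact: nsq_rowop.
Qed.

Lemma pencil_inj l : inball l -> injective (pencil l).
Proof.
move=> bl x y eq_xy; apply/eqP; rewrite -subr_eq0; apply/eqP; apply: nsq_le0.
apply: le_trans (nsq_le_pencil _ bl) _.
by rewrite (linB (pencil_linear l)) eq_xy subrr nsq0 mulr0.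
Qed.

(* The adjoint of [pencil l] is bounded below too, so it has a bounded left inverse; the
   adjoint of the latter is a right inverse of [pencil l]. *)
Lemma pencil_surj l x : inball l -> exists y, pencil l y = x.
Proof.
move=> bl; have /inballE l1 := bl.
have bA : hbop (rowop A l) by apply: rowop_bop => j; apply: column_contraction_bop.
pose E := hadj (rowop A l).
have [s|T [_ T_adj _]] := bounded_family_adjoint (a := fun w => w - E w) (b := id)
  (res_const_ge0 (psq l)).
  have lin_idE : linear (fun w => w - E w) by move=> a y w; rewrite /E adj_linear //; hilb_ring.
  rewrite -[(fun w => w - E w)]/((fun w => w - E w) \o id) -(lin_lincomb id s lin_idE).
  apply: nsq_le_sub_contraction => //; first exact: psq_ge0.
  by apply: adj_bound => //; [exact: psq_ge0 | exact: nsq_rowop].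
exists (T x); apply: hip_ext => w.
by rewrite -[RHS](T_adj w x) /pencil hipBr hipBl (adjP_sym bA).
Qed.

Definition res l x : X := epsilon (inhabits 0) (fun y => pencil l y = x).

Lemma resK l x : inball l -> pencil l (res l x) = x.
Proof.
move=> bl; exact: (epsilon_spec (inhabits 0) (fun y => pencil l y = x) (pencil_surj x bl)).
Qed.

Lemma pencilK l x : inball l -> res l (pencil l x) = x.
Proof. by move=> bl; apply: (pencil_inj bl); rewrite resK. Qed.

Lemma res_unique l x y : inball l -> pencil l y = x -> res l x = y.
Proof. by move=> bl <-; rewrite pencilK. Qed.

Lemma res_linear l : inball l -> linear (res l).
Proof. by move=> bl a x y; apply: res_unique; rewrite ?pencil_linear ?resK. Qed.

Lemma nsq_res l x : inball l -> hnsq (res l x) <= res_const (psq l) * hnsq x.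
Proof. by move=> bl; rewrite -[in leRHS](resK x bl); exact: nsq_le_pencil. Qed.

Lemma nsq_res_le rho l x : psq l <= rho -> rho < 1 -> hnsq (res l x) <= res_const rho * hnsq x.
Proof.
move=> l_rho rho1; have bl : inball l by apply/inballE; apply: le_lt_trans rho1.
apply: le_trans (nsq_res x bl) _; apply: ler_wpM2r; first exact: nsq_ge0.
exact: res_const_le.
Qed.

Lemma res_bop l : inball l -> hbop (res l).
Proof.
by move=> bl; split; [exact: res_linear | exists (res_const (psq l)) => x; exact: nsq_res].
Qed.

Lemma res0 x : res pt0 x = x.
Proof. by apply: res_unique; [exact: inball0 | rewrite /pencil rowop0 subr0]. Qed.

Lemma rowop_res l x : inball l -> rowop A l (res l x) = res l x - x.
Proof. by move=> bl; rewrite -[in RHS](resK x bl) /pencil pencilK //; hilb_ring. Qed.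

Lemma res_sub l z x : inball l -> inball z ->
  res l x - res z x = res l (rowop A (ptsub l z) (res z x)).
Proof.
move=> bl bz; apply/esym/res_unique => //.
rewrite rowop_sub rowop_res // (linB (pencil_linear l)) resK // /pencil.
by hilb_ring.
Qed.

Lemma res_scale_sub l (s t : C) x : inball (ptscale s l) -> inball (ptscale t l) ->
  t *: res (ptscale t l) x - s *: res (ptscale s l) x =
  (t - s) *: res (ptscale s l) (res (ptscale t l) x).
Proof.
move=> bs bt; rewrite -[RHS](linZ (res_linear bs)); apply/esym/res_unique => //.
rewrite (linB (pencil_linear _)) !(linZ (pencil_linear _)) resK // /pencil rowop_scale.
have /eqP := rowop_res x bt; rewrite rowop_scale.
set r := res (ptscale t l) x => /eqP row_r.
transitivity (t *: r - s *: x - s *: (t *: rowop A l r)); first by hilb_ring.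
by rewrite row_r; hilb_ring.
Qed.

End Resolvent.

Lemma res_intertwine (R : realType) (d : nat) (X X' : hilb R) (A : 'I_d -> X -> X)
    (A' : 'I_d -> X' -> X') (T : X -> X') :
  column_contraction A -> column_contraction A' -> linear T ->
  (forall j x, T (A j x) = A' j (T x)) ->
  forall l x, inball l -> T (res A l x) = res A' l (T x).
Proof.
move=> contrA contrA' linT TA l x bl; apply/esym/(res_unique contrA') => //.
rewrite -[in RHS](resK contrA x bl) /pencil (linB linT) /rowop (lin_sum linT); congr (_ - _).
by apply: eq_bigr => j _; rewrite (linZ linT) TA.
Qed.

Section Observability.
Variables (R : realType) (d : nat) (X Y : hilb R) (A : 'I_d -> X -> X) (Cc : X -> Y).
Local Notation C := R[i].
Hypothesis contrA : column_contraction A.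
Hypothesis bC : hbop Cc.
Implicit Types (l z : pt R d) (x : X).

Definition obs l x : Y := Cc (res A l x).

Lemma obs_bop l : inball l -> hbop (obs l).
Proof. by move=> bl; apply: bop_comp bC; exact: res_bop. Qed.

Lemma obs0 x : obs pt0 x = Cc x.
Proof. by rewrite /obs res0. Qed.

Lemma obs_lipschitz rho : rho < 1 -> exists2 K, 0 <= K & forall l z x,
  psq l <= rho -> psq z <= rho ->
  hnsq (obs l x - obs z x) <= K * psq (ptsub l z) * hnsq x.
Proof.
move=> rho1; have [M M0 C_le] := bop_ge0 bC; pose k := res_const rho.
have k0 : 0 <= k by exact: res_const_ge0.
exists (M * k ^+ 2) => [|l z x l_rho z_rho]; first by rewrite mulr_ge0 ?sqr_ge0.
have bl : inball l by apply/inballE; apply: le_lt_trans rho1.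
have bz : inball z by apply/inballE; apply: le_lt_trans rho1.
rewrite /obs -(linB bC.1) res_sub //; apply: le_trans (C_le _) _.
have -> : M * k ^+ 2 * psq (ptsub l z) * hnsq x = M * (k * (psq (ptsub l z) * (k * hnsq x))).
  by ring.
apply: ler_wpM2l => //; apply: le_trans (nsq_res_le contrA _ l_rho rho1) _; apply: ler_wpM2l => //.
apply: le_trans (nsq_rowop contrA _ _) _; apply: ler_wpM2l; first exact: psq_ge0.
exact: nsq_res_le.
Qed.

Definition unobservable x : Prop := forall l, inball l -> obs l x = 0.

Hypothesis commA : forall i j x, A i (A j x) = A j (A i x).

Lemma res_comm l j x : inball l -> A j (res A l x) = res A l (A j x).
Proof. by apply: res_intertwine => //; exact: contrA.1. Qed.

(* [res l (res l (A j x))] is the [j]-th partial derivative of [res l x]. *)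
Lemma unobservable_res x j l : unobservable x -> inball l -> obs l (res A l (A j x)) = 0.
Proof.
move=> obs_x bl; have /inballE l1 := bl; pose rho := (1 + psq l) / 2.
have rho1 : rho < 1 by rewrite /rho; lra.
rewrite -res_comm //; set w := A j _; have [K K0 lipK] := obs_lipschitz rho1.
apply: nsq_le0; apply: (@le0_gt0_mul _ _ (K * hnsq w)) => e e0.
pose h : R := Num.min e (Num.min 1 ((1 - psq l) / 6)).
have h0 : 0 < h by rewrite !lt_min e0 ltr01 divr_gt0 // subr_gt0.
have he : h ^+ 2 <= e.
  rewrite expr2 -[e]mulr1; apply: ler_pM; rewrite ?(ltW h0) // /h ge_min ?lexx //.
  by rewrite ge_min lexx orbT.
pose l' := ptadd l (ptdelta j h%:C).
have l'_rho : psq l' <= rho.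
  by apply: (psqD_le_mid (lexx _) l1 h0); rewrite ?psq_delta ?csq_real // /h !ge_min lexx !orbT.
have bl' : inball l' by apply/inballE; apply: le_lt_trans rho1.
have l_rho : psq l <= rho by rewrite /rho; lra.
have sub_l' : ptsub l' l = ptdelta j h%:C.
  by apply/funext => i; rewrite /ptsub /l' /ptadd addrC addKr.
have obs_w : obs l' w = 0.
  have := congr1 Cc (res_sub contrA x bl' bl).
  rewrite (linB bC.1) -!/(obs _ _) !obs_x // subrr sub_l' rowop_delta.
  rewrite -/w (linZ (obs_bop bl').1) => /esym/eqP.
  by rewrite scaler_eq0 (inj_eq (@complexI R)) gt_eqF //= => /eqP.
have := lipK l' l w l'_rho l_rho.
rewrite obs_w sub0r nsqN sub_l' psq_delta csq_real => /le_trans; apply.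
by rewrite mulrAC mulrC; apply: ler_wpM2r => //; rewrite mulr_ge0 ?nsq_ge0.
Qed.

Lemma obs_scale_sub l (s t : C) x j : unobservable x ->
  inball (ptscale s l) -> inball (ptscale t l) ->
  t *: obs (ptscale t l) (A j x) - s *: obs (ptscale s l) (A j x) =
  (t - s) ^+ 2 *: obs (ptscale s l)
    (res A (ptscale t l) (rowop A l (res A (ptscale s l) (A j x)))).
Proof.
move=> obs_x bs bt; have obs_linear := (obs_bop bs).1.
rewrite /obs -2!(linZ bC.1) -(linB bC.1) res_scale_sub // (linZ bC.1).
have -> : res A (ptscale t l) (A j x) = res A (ptscale s l) (A j x) +
    (t - s) *: res A (ptscale t l) (rowop A l (res A (ptscale s l) (A j x))).
  rewrite -(linZ (res_linear contrA bt)) -rowop_scale.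
  have -> : ptscale (t - s) l = ptsub (ptscale t l) (ptscale s l).
    by apply/funext => i; rewrite /ptsub /ptscale mulrBl.
  by rewrite -res_sub // addrC subrK.
by rewrite -!/(obs _ _) (linD obs_linear) unobservable_res // add0r (linZ obs_linear) scalerA.
Qed.

(* [s |-> s *: obs (s l) (A j x)] has increments of second order, hence is constant. *)
Lemma unobservable_invariant x j : unobservable x -> unobservable (A j x).
Proof.
move=> obs_x l bl; have /inballE l1 := bl; pose k := res_const (psq l).
have k0 : 0 <= k by exact: res_const_ge0.
have sl_le (s : R) : 0 <= s <= 1 -> psq (ptscale s%:C l) <= psq l.
  by move=> /andP[s0 s1]; rewrite psq_scale csq_real ler_piMl ?psq_ge0 // exprn_ile1.
have bsl s : 0 <= s <= 1 -> inball (ptscale s%:C l).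
  by move=> /sl_le s_le; apply/inballE; apply: le_lt_trans l1.
have [M M0 C_le] := bop_ge0 bC.
pose v (s : R) : Y := s%:C *: obs (ptscale s%:C l) (A j x).
have -> : obs l (A j x) = v 1.
  by rewrite /v scale1r; congr (obs _ _); apply/funext => i; rewrite /ptscale mul1r.
have -> : 0 = v 0 by rewrite /v scale0r.
apply: (@flat_path_constant _ _ _ (M * (k * (k * (k * hnsq (A j x)))))) => s t s01 t01.
rewrite /v (obs_scale_sub _ obs_x (bsl s s01) (bsl t t01)).
rewrite -(rmorphB (real_complex R)) -(rmorphXn (real_complex R)).
rewrite nsqZ csq_real; apply: ler_wpM2l; first exact: sqr_ge0.
apply: le_trans (C_le _) _; apply: ler_wpM2l => //.
apply: le_trans (nsq_res_le contrA _ (sl_le _ s01) l1) _; apply: ler_wpM2l => //.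
apply: le_trans (nsq_res_le contrA _ (sl_le _ t01) l1) _; apply: ler_wpM2l => //.
apply: le_trans (nsq_rowop contrA _ _) _; apply: le_trans (nsq_res_le contrA _ (sl_le _ s01) l1).
by rewrite ler_piMl ?nsq_ge0 // ltW.
Qed.

End Observability.

(* Two systems with the same output stay so after applying [A j]: their difference is a system
   on the direct sum, for which [(x, x')] is unobservable. *)
Lemma obs_eq_invariant (R : realType) (d : nat) (X X' Y : hilb R)
    (A : 'I_d -> X -> X) (Cc : X -> Y) (A' : 'I_d -> X' -> X') (Cc' : X' -> Y) :
  column_contraction A -> hbop Cc -> (forall i j x, A i (A j x) = A j (A i x)) ->
  column_contraction A' -> hbop Cc' -> (forall i j x, A' i (A' j x) = A' j (A' i x)) ->
  forall x x', (forall l, inball l -> obs A Cc l x = obs A' Cc' l x') ->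
  forall j l, inball l -> obs A Cc l (A j x) = obs A' Cc' l (A' j x').
Proof.
move=> contrA bC commA contrA' bC' commA' x x' obs_xx' j l bl.
pose S := hprod X X'.
pose AS i (p : S) : S := (A i p.1, A' i p.2); pose CS (p : S) : Y := Cc p.1 - Cc' p.2.
have contrAS : column_contraction AS.
  split=> [i a p q|p]; first by rewrite /AS /= contrA.1 contrA'.1.
  under eq_bigr do rewrite nsq_prod.
  by rewrite big_split /= nsq_prod; apply: lerD; [exact: contrA.2 | exact: contrA'.2].
have bCS : hbop CS.
  have := bopD (bop_comp (contraction_bop (contraction_fst X X')) bC)
    (bopZ (-1) (bop_comp (contraction_bop (contraction_snd X X')) bC')).
  by congr hbop; apply/funext => p; rewrite scaleN1r.
have obsS l' p : inball l' -> obs AS CS l' p = obs A Cc l' p.1 - obs A' Cc' l' p.2.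
  move=> bl'; rewrite /obs /CS; congr (Cc _ - Cc' _).
    by apply: (res_intertwine (T := fun p : S => p.1)).
  by apply: (res_intertwine (T := fun p : S => p.2)).
have obsS_xx' : unobservable AS CS (x, x').
  by move=> l' bl'; rewrite obsS //= obs_xx' // subrr.
have commAS i k (p : S) : AS i (AS k p) = AS k (AS i p) by rewrite /AS /= commA commA'.
have := unobservable_invariant contrAS bCS commAS j obsS_xx' bl.
by rewrite obsS //= => /eqP; rewrite subr_eq0 => /eqP.
Qed.

(* The Gleason identity says that [fn (pencil A l x) l = fn x pt0]. *)
Lemma obs_of_gleason (R : realType) (d : nat) (X Y : hilb R) (A : 'I_d -> X -> X)
    (fn : X -> pt R d -> Y) :
  column_contraction A -> (forall l, linear (fun x => fn x l)) ->
  (forall x l, inball l -> fn x l - fn x pt0 = \sum_(j < d) l j *: fn (A j x) l) ->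
  forall l x, inball l -> obs A (fun y => fn y pt0) l x = fn x l.
Proof.
move=> contrA fn_lin gleason l x bl.
have := congr1 (fun y => fn y l) (rowop_res contrA x bl).
rewrite (linB (fn_lin l)) /rowop (lin_sum (fn_lin l)).
under eq_bigr do rewrite (linZ (fn_lin l)).
by rewrite -gleason // => /addrI/oppr_inj.
Qed.

(** * Reproducing kernel Hilbert spaces *)

Section SubmoduleType.
Variables (K : pzRingType) (V : lmodType K).

Record submodule := SubModule {
  submod_pred : V -> Prop;
  submod_pred0 : submod_pred 0;
  submod_pred_linear : forall (a : K) x y,
    submod_pred x -> submod_pred y -> submod_pred (a *: x + y) }.

Definition submod_mem (S : submodule) : {pred V} := fun x => `[< submod_pred S x >].

Lemma submod_memP S x : reflect (submod_pred S x) (x \in submod_mem S).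
Proof. exact: asboolP. Qed.

Lemma submod_mem_closed S : submod_closed (submod_mem S).
Proof.
split; first by apply/submod_memP; exact: submod_pred0.
by move=> a x y /submod_memP Sx /submod_memP Sy; apply/submod_memP; exact: submod_pred_linear.
Qed.

HB.instance Definition _ S :=
  GRing.isSubmodClosed.Build K V (submod_mem S) (submod_mem_closed S).

Record submod_type (S : submodule) :=
  SubmodElt { submod_val :> V; _ : submod_val \in submod_mem S }.

HB.instance Definition _ S := [isSub for @submod_val S].
HB.instance Definition _ S := [Choice of submod_type S by <:].
HB.instance Definition _ S := [SubChoice_isSubLmodule of submod_type S by <:].

Lemma submod_valP S (x : submod_type S) : submod_pred S (submod_val x).
Proof. by case: x => x Sx; apply/submod_memP. Qed.

Definition submod_elt S x (Sx : submod_pred S x) : submod_type S :=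
  SubmodElt (introT (submod_memP S x) Sx).

End SubmoduleType.

Lemma bounded_additive_eq0 (R : archiRealFieldType) (phi : {additive R -> R}) (B : R) :
  (forall t, `|phi t| <= B) -> forall t, phi t = 0.
Proof.
move=> phi_le t; apply/eqP; rewrite -normr_le0; apply: (@le0_gt0_mul _ _ B) => e.
move=> /invS_small[N /(_ N (leqnn N)) ltN]; have B0 := le_trans (normr_ge0 _) (phi_le 0).
apply: le_trans (_ : N.+1%:R^-1 * B <= _); last by apply: ler_wpM2r => //; exact: ltW.
rewrite -ler_pdivrMl ?invr_gt0 ?ltr0n // invrK; apply: le_trans (phi_le (N.+1%:R * t)).
by rewrite mulr_natl raddfMn normrMn mulr_natl.
Qed.

Lemma locally_bounded_additive_linear (R : archiRealFieldType) (phi : {additive R -> R}) (B : R) :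
  (forall t, 0 <= t <= 1 -> `|phi t| <= B) -> forall t, phi t = t * phi 1.
Proof.
move=> phi_le t; pose delta s := phi s - s * phi 1.
have delta_additive : zmod_morphism delta by move=> x y; rewrite /delta raddfB; ring.
pose deltaA : {additive R -> R} :=
  HB.pack delta (GRing.isZmodMorphism.Build R R delta delta_additive).
apply/eqP; rewrite -subr_eq0; apply/eqP.
apply: (@bounded_additive_eq0 R deltaA (B + `|phi 1|)) => s /=.
have floor_mul : delta (Num.floor s)%:~R = 0.
  by rewrite /delta -[X in phi X]mulr1 mulrzl raddfMz mulrzl subrr.
have -> : delta s = delta (s - (Num.floor s)%:~R) by rewrite delta_additive floor_mul subr0.
have /andP[fr_ge0 fr_lt1] : 0 <= s - (Num.floor s)%:~R < 1.
  by have := floor_itv s; rewrite intrD => /andP[? ?]; lra.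
apply: le_trans (ler_normB _ _) _; apply: lerD; first by rewrite phi_le // fr_ge0 ltW.
by rewrite normrM ger0_norm // ler_piMl // ltW.
Qed.

Section JordanVonNeumann.
Variable R : realType.
Local Notation C := R[i].
Variables (V : lmodType C) (N : V -> R).
Hypothesis N_ge0 : forall x, 0 <= N x.
Hypothesis N_scale : forall (a : C) x, N (a *: x) = csq a * N x.
Hypothesis N_parallelogram : forall x y, N (x + y) + N (x - y) = 2 * N x + 2 * N y.

Let polar x y := (N (x + y) - N (x - y)) / 4.

Definition jvn (x y : V) : C := (polar x y) +i* (polar x ('i%C *: y)).

Let N_opp x : N (- x) = N x.
Proof. by rewrite -scaleN1r N_scale csqN csq1 mul1r. Qed.

Let polarC x y : polar x y = polar y x.
Proof. by rewrite /polar (addrC x y) -(N_opp (x - y)) opprB. Qed.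

Let polar0 y : polar 0 y = 0.
Proof. by rewrite /polar add0r sub0r N_opp subrr mul0r. Qed.

Let polarD_double x x' y : polar (x + x') (y + y) = 2 * (polar x y + polar x' y).
Proof.
have := N_parallelogram (x + y) (x' + y); have := N_parallelogram (x - y) (x' - y).
have -> : x + y + (x' + y) = x + x' + (y + y) by rewrite addrACA.
have -> : x - y + (x' - y) = x + x' - (y + y) by rewrite addrACA opprD.
have -> : x + y - (x' + y) = x - x' by rewrite opprD addrACA subrr addr0.
have -> : x - y - (x' - y) = x - x' by rewrite opprD addrACA opprK addNr addr0.
by rewrite /polar; lra.
Qed.

Let polarD x x' y : polar (x + x') y = polar x y + polar x' y.
Proof.
have := polarD_double (x + x') 0 y; have := polarD_double x x' y.
by rewrite addr0 polar0; lra.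
Qed.

Let polarN x y : polar (- x) y = - polar x y.
Proof. by apply: (addrI (polar x y)); rewrite -polarD !subrr polar0. Qed.

Let polarZ (t : R) x y : polar (t%:C *: x) y = t * polar x y.
Proof.
pose phi s := polar (s%:C *: x) y.
have phi_additive : zmod_morphism phi.
  by move=> s s'; rewrite /phi (rmorphB (real_complex R)) /= scalerBl polarD polarN.
pose phiA : {additive R -> R} := HB.pack phi (GRing.isZmodMorphism.Build R R phi phi_additive).
have := @locally_bounded_additive_linear R phiA ((N x + N y) / 2).
rewrite /= /phi scale1r => -> // s /andP[s0 s1].
have le_N : N (s%:C *: x) <= N x by rewrite N_scale csq_real ler_piMl // exprn_ile1.
have := N_parallelogram (s%:C *: x) y.
have := N_ge0 (s%:C *: x + y); have := N_ge0 (s%:C *: x - y).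
by rewrite /polar ler_norml => *; apply/andP; split; lra.
Qed.

Let polar_ii x y : polar ('i%C *: x) ('i%C *: y) = polar x y.
Proof. by rewrite /polar -scalerDr -scalerBr !N_scale csqi !mul1r. Qed.

Let polar_il x y : polar ('i%C *: x) y = - polar x ('i%C *: y).
Proof. by rewrite -polar_ii scalerA -expr2 sqr_i scaleN1r polarN. Qed.

Lemma jvn_linl (a : C) x y z : jvn (a *: x + y) z = a * jvn x z + jvn y z.
Proof.
have -> : a *: x = (complex.Re a)%:C *: x + (complex.Im a)%:C *: ('i%C *: x).
  by rewrite {1}[a]complexE scalerDl scalerA [_ * 'i%C]mulrC.
rewrite /jvn !polarD !polarZ !polar_il.
have -> : polar x ('i%C *: ('i%C *: z)) = - polar x z.
  by rewrite scalerA -expr2 sqr_i scaleN1r polarC polarN polarC.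
by case: a => a1 a2; apply: complex_ext => /=; ring.
Qed.

Lemma jvn_sym x y : jvn y x = conjc (jvn x y).
Proof. by rewrite /jvn /=; congr (_ +i* _); rewrite polarC // polar_il. Qed.

Lemma jvnxx x : jvn x x = (N x)%:C.
Proof.
rewrite /jvn /polar; apply: complex_ext => /=.
  have -> : x + x = 2%:C *: x by rewrite rmorph_nat scaler_nat mulr2n.
  have -> : x - x = 0%:C *: x by rewrite subrr scale0r.
  by rewrite !N_scale !csq_real; field.
have -> : x + 'i%C *: x = (1 + 'i%C) *: x by rewrite scalerDl scale1r.
have -> : x - 'i%C *: x = (1 - 'i%C) *: x by rewrite scalerBl scale1r.
by rewrite !N_scale /csq /=; field.
Qed.

Lemma jvn_polarization x y :
  jvn x y = 4%:R^-1 * \sum_(k < 4) 'i%R ^+ k * (N (x + 'i%R ^+ k *: y))%:C.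
Proof.
rewrite !big_ord_recr big_ord0 /= -complexiE expr0 expr1 sqr_i.
have -> : 'i%C ^+ 3 = - 'i%C :> C by rewrite exprS sqr_i mulrN1.
rewrite scale1r !scaleNr scale1r add0r mul1r.
have -> : (4^-1 : C) = (4^-1 : R)%:C by rewrite (fmorphV (real_complex R)) rmorph_nat.
by rewrite /jvn /polar; apply: complex_ext => /=; field.
Qed.

End JordanVonNeumann.

Section KernelForms.
Variables (R : realType) (d : nat) (Y : hilb R).
Local Notation C := R[i].
Implicit Types (f g : pt R d -> Y) (a : C).

Definition bpt : Type := {l : pt R d | inball l}.
Definition fam : Type := seq (bpt * Y).
Implicit Types s t : fam.

Definition famZ a s : fam := [seq (p.1, a *: p.2) | p <- s].

Definition pairing f s : C := \sum_(p <- s) hip (f (sval p.1)) p.2.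

Lemma pairing_nil f : pairing f [::] = 0.
Proof. exact: big_nil. Qed.

Lemma pairing_cat f s t : pairing f (s ++ t) = pairing f s + pairing f t.
Proof. exact: big_cat. Qed.

Lemma pairing_famZ f a s : pairing f (famZ a s) = conjc a * pairing f s.
Proof. by rewrite /pairing big_map mulr_sumr; apply: eq_bigr => p _; rewrite hipZr. Qed.

Lemma pairing1 f z y : pairing f [:: (z, y)] = hip (f (sval z)) y.
Proof. exact: big_seq1. Qed.

Lemma pairingD f g s : pairing (fun l => f l + g l) s = pairing f s + pairing g s.
Proof. by rewrite /pairing -big_split; apply: eq_bigr => p _; rewrite hipDl. Qed.

Lemma pairingB f g s : pairing (fun l => f l - g l) s = pairing f s - pairing g s.
Proof. by rewrite /pairing -sumrB; apply: eq_bigr => p _; rewrite hipBl. Qed.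

Lemma pairingZ a f s : pairing (fun l => a *: f l) s = a * pairing f s.
Proof. by rewrite /pairing mulr_sumr; apply: eq_bigr => p _; rewrite hipZl. Qed.

Lemma eq_pairing f g s : (forall l, inball l -> f l = g l) -> pairing f s = pairing g s.
Proof. by move=> fg; apply: eq_bigr => p _; rewrite fg //; exact: svalP. Qed.

Lemma pairing_le_limit (u : nat -> pt R d -> Y) f s :
  (forall l, inball l -> ip_cvg (@hip R Y) (fun n => u n l) (f l)) ->
  forall e : R, 0 < e -> exists N : nat, forall n, (N <= n)%N ->
    complex.Re (pairing f s) <= complex.Re (pairing (u n) s) + e.
Proof.
move=> u_f; elim: s => [|[z y] s IHs] e e0.
  by exists 0%N => n _; rewrite !pairing_nil add0r ltW.
have [N uN] := IHs (e / 2) ltac:(lra).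
have q0 : 0 < hnsq y + 1 by have := nsq_ge0 y; lra.
have e2 : 0 < (e / 2) ^+ 2 / (hnsq y + 1) by rewrite divr_gt0 ?exprn_gt0 //; lra.
have [N' uN'] := u_f _ (svalP z) _ e2; exists (N + N')%N => n Nn.
rewrite -cat1s !pairing_cat !ReD !pairing1 -!/(rip _ _).
have := uN n (leq_trans (leq_addr _ _) Nn).
have := uN' n (leq_trans (leq_addl _ _) Nn); rewrite ltr_pdivlMr //.
have := rip_CauchySchwarz (u n (sval z) - f (sval z)) y; rewrite ripBl.
move: q0 (nsq_ge0 (u n (sval z) - f (sval z))).
set r := rip (u n _) _; set r' := rip (f _) _; move: (hnsq y) (hnsq _) => q x q0 x0.
move=> r_le x_lt pair_le.
suff : r' - r <= e / 2 by lra.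
rewrite leNgt; apply/negP => lt_r.
have : (e / 2) * (e / 2) < (r' - r) * (r' - r) by apply: ltr_pM => //; lra.
by lra.
Qed.

Variable K : pt R d -> pt R d -> Y -> Y.

Definition kform s t : C := \sum_(p <- s) \sum_(p' <- t) hip (K (sval p.1) (sval p'.1) p'.2) p.2.

Definition kquad s : R := complex.Re (kform s s).

Definition kspan t : pt R d -> Y := fun l => \sum_(p <- t) K l (sval p.1) p.2.

Lemma kform_catl s s' t : kform (s ++ s') t = kform s t + kform s' t.
Proof. exact: big_cat. Qed.

Lemma kform_catr s t t' : kform s (t ++ t') = kform s t + kform s t'.
Proof. by rewrite /kform -big_split; apply: eq_bigr => p _; rewrite big_cat. Qed.

Lemma kform_famZl a s t : kform (famZ a s) t = conjc a * kform s t.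
Proof.
rewrite /kform big_map mulr_sumr; apply: eq_bigr => p _; rewrite mulr_sumr.
by apply: eq_bigr => p' _; rewrite hipZr.
Qed.

Lemma kform1 z y z' y' : kform [:: (z, y)] [:: (z', y')] = hip (K (sval z) (sval z') y') y.
Proof. by rewrite /kform !big_seq1. Qed.

Lemma kspan1 z y l : kspan [:: (z, y)] l = K l (sval z) y.
Proof. exact: big_seq1. Qed.

Lemma pairing_kspan s t : pairing (kspan t) s = kform s t.
Proof. by apply: eq_bigr => p _; rewrite hip_suml. Qed.

Lemma rk_bound_fam f (c : R) : rk_bound (@hip R Y) K f c <->
  0 <= c /\ forall s, `|pairing f s| ^+ 2 <= c%:C * kform s s.
Proof.
split=> -[c0 f_le]; split=> //.
  move=> s; have := f_le (size s) (fun i => sval (tnth (in_tuple s) i).1)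
    (fun i => (tnth (in_tuple s) i).2) (fun i => svalP (tnth (in_tuple s) i).1).
  rewrite /pairing /kform 2!(big_tnth _ _ s).
  by under [in X in _ -> _ <= _ * X]eq_bigr do rewrite (big_tnth _ _ s).
move=> n ls ys ls_ball.
have := f_le [seq (exist _ (ls i) (ls_ball i) : bpt, ys i) | i <- index_enum 'I_n].
rewrite /pairing /kform !big_map /=.
by under [in X in (_ <= _ * X) -> _]eq_bigr do rewrite big_map.
Qed.

Record pos_kernel : Prop := PosKernel {
  pk_linear : forall l z, inball l -> inball z -> linear (K l z);
  pk_sym : forall l z y y', inball l -> inball z -> hip (K l z y) y' = conjc (hip (K z l y') y);
  pk_pos : forall s, 0 <= kquad s;
  pk_bounded : forall z, inball z ->
    exists M : R, forall y, complex.Re (hip (K z z y) y) <= M * hnsq y }.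

Hypothesis pK : pos_kernel.

Lemma kform_famZr a s t : kform s (famZ a t) = a * kform s t.
Proof.
rewrite /kform mulr_sumr; apply: eq_bigr => p _; rewrite big_map mulr_sumr.
apply: eq_bigr => p' _.
by rewrite (linZ (pk_linear pK (svalP p.1) (svalP p'.1))) hipZl.
Qed.

Lemma kform_sym s t : kform t s = conjc (kform s t).
Proof.
rewrite /kform rmorph_sum exchange_big /=; apply: eq_bigr => p _; rewrite rmorph_sum.
by apply: eq_bigr => p' _; rewrite (pk_sym pK _ _ (svalP _) (svalP _)).
Qed.

Lemma kformxx s : kform s s = (kquad s)%:C.
Proof.
apply: complex_ext => //=.
by have := congr1 (@complex.Im R) (kform_sym s s); case: (kform s s) => a b /= ?; lra.
Qed.

Lemma kquad_cat s t : kquad (s ++ t) = kquad s + kquad t + 2 * complex.Re (kform s t).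
Proof. by rewrite /kquad kform_catl !kform_catr !ReD (kform_sym s t) ReJ; lra. Qed.

Lemma kquad_famZ a s : kquad (famZ a s) = csq a * kquad s.
Proof. by rewrite /kquad kform_famZl kform_famZr mulrA [_ * a]mulrC mulcJ Re_realM. Qed.

Lemma kspan_famZ a t l : inball l -> kspan (famZ a t) l = a *: kspan t l.
Proof.
move=> bl; rewrite /kspan big_map scaler_sumr; apply: eq_bigr => p _ /=.
by rewrite (linZ (pk_linear pK bl (svalP p.1))).
Qed.

Lemma kform_CauchySchwarz s t : csq (kform s t) <= kquad t * kquad s.
Proof.
apply: ler_of_sqr_le_mul; first by rewrite mulr_ge0 // (pk_pos pK).
rewrite -mulrA; apply: discriminant_le0; first by rewrite mulr_ge0 ?csq_ge0 ?(pk_pos pK).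
move=> r; have := pk_pos pK (t ++ famZ (r%:C * kform s t) s).
rewrite kquad_cat kquad_famZ kform_famZr csqM csq_real (kform_sym s t) -[_ * _ * conjc _]mulrA.
by rewrite mulcJ Re_realM /=; nra.
Qed.

Lemma rk_bound_csq f c : rk_bound (@hip R Y) K f c <->
  0 <= c /\ forall s, csq (pairing f s) <= c * kquad s.
Proof.
rewrite rk_bound_fam; split=> -[c0 f_le]; split=> // s; move: (f_le s);
  by rewrite sqr_normC_csq kformxx -(rmorphM (real_complex R)) lecR.
Qed.

(* So the squared norm of [f] in H(K) is the supremum over [s] of [2 Re (pairing f s) - kquad s]. *)
Lemma rk_boundE f c : rk_bound (@hip R Y) K f c <->
  forall s, 2 * complex.Re (pairing f s) - kquad s <= c.
Proof.
rewrite rk_bound_csq; split=> [[c0 f_le] s|f_le].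
  rewrite lerBlDr; apply: amgm => //; first exact: (pk_pos pK).
  exact: le_trans (sqr_Re_le _) (f_le s).
have c0 : 0 <= c by have := f_le [::]; rewrite pairing_nil /kquad /kform big_nil /= mulr0 subrr.
split=> // s; apply: ler_of_sqr_le_mul; first by rewrite mulr_ge0 ?(pk_pos pK).
rewrite -mulrA; apply: discriminant_le0; first by rewrite mulr_ge0 ?csq_ge0 ?(pk_pos pK).
move=> r; have := f_le (famZ (- r)%:C (famZ (pairing f s) s)).
rewrite !pairing_famZ !kquad_famZ conjc_real csq_real [conjc _ * pairing _ _]mulrC mulcJ.
by rewrite Re_realM /=; nra.
Qed.

End KernelForms.

Section KernelSpaceNorm.
Variables (R : realType) (d : nat) (Y : hilb R) (K : pt R d -> pt R d -> Y -> Y).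
Hypothesis pK : pos_kernel K.
Local Notation C := R[i].
Local Notation N := (rk_nsq (@hip R Y) K).
Local Notation inrk := (in_rk (@hip R Y) K).
Implicit Types (f g : pt R d -> Y) (s t : fam d Y) (a : C).

Lemma rk_nsq_le f c : rk_bound (@hip R Y) K f c -> N f <= c.
Proof. by move=> f_le; apply: ge_inf => //; exists 0 => r []. Qed.

Lemma rk_bound_rk_nsq f : inrk f -> rk_bound (@hip R Y) K f (N f).
Proof.
move=> [c f_le]; apply/(rk_boundE pK) => s; apply: lb_le_inf; first by exists c.
by move=> r /(rk_boundE pK).
Qed.

Lemma rk_nsq_ge f s : inrk f -> 2 * complex.Re (pairing f s) - kquad K s <= N f.
Proof. by move=> /rk_bound_rk_nsq/(rk_boundE pK). Qed.

Lemma rk_nsq_ge0 f : inrk f -> 0 <= N f.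
Proof. by case/rk_bound_rk_nsq. Qed.

Lemma csq_pairing_le f s : inrk f -> csq (pairing f s) <= N f * kquad K s.
Proof. by move=> /rk_bound_rk_nsq/(rk_bound_csq pK)[]. Qed.

Lemma eq_rk_bound f g c : (forall l, inball l -> f l = g l) ->
  rk_bound (@hip R Y) K f c -> rk_bound (@hip R Y) K g c.
Proof. by move=> fg; rewrite !(rk_boundE pK) => f_le s; rewrite -(eq_pairing s fg). Qed.

Lemma eq_in_rk f g : (forall l, inball l -> f l = g l) -> inrk f -> inrk g.
Proof. by move=> fg [c f_le]; exists c; apply: eq_rk_bound f_le. Qed.

Lemma eq_rk_nsq f g : (forall l, inball l -> f l = g l) -> N f = N g.
Proof.
move=> fg; rewrite /rk_nsq; congr inf; apply/seteqP; split=> c /=; apply: eq_rk_bound => // l bl.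
by rewrite fg.
Qed.

Lemma eq_rk_ip f g f' g' : (forall l, inball l -> f l = f' l) ->
  (forall l, inball l -> g l = g' l) -> rk_ip (@hip R Y) K f g = rk_ip (@hip R Y) K f' g'.
Proof.
move=> ff' gg'; rewrite /rk_ip; congr (_ * _); apply: eq_bigr => k _; congr (_ * _%:C).
by apply: eq_rk_nsq => l bl; rewrite ff' ?gg'.
Qed.

Lemma in_rkZ a f : inrk f -> inrk (fun l => a *: f l).
Proof.
move=> [c /(rk_bound_csq pK)[c0 f_le]]; exists (csq a * c); apply/(rk_bound_csq pK).
split=> [|s]; first by rewrite mulr_ge0 ?csq_ge0.
by rewrite pairingZ csqM -mulrA; apply: ler_wpM2l => //; exact: csq_ge0.
Qed.

Lemma in_rkD f g : inrk f -> inrk g -> inrk (fun l => f l + g l).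
Proof.
move=> [c /(rk_bound_csq pK)[c0 f_le]] [c' /(rk_bound_csq pK)[c'0 g_le]].
exists (2 * c + 2 * c'); apply/(rk_bound_csq pK); split=> [|s]; first by lra.
have := @csqD_young R 1 (pairing f s) (pairing g s) ltr01; rewrite invr1 pairingD.
by have := f_le s; have := g_le s; lra.
Qed.

Lemma in_rkB f g : inrk f -> inrk g -> inrk (fun l => f l - g l).
Proof.
by move=> f_in g_in; apply: eq_in_rk (in_rkD f_in (in_rkZ (-1) g_in)) => l _; rewrite scaleN1r.
Qed.

Lemma in_rk0 : inrk (fun _ => 0).
Proof.
exists 0; apply/(rk_boundE pK) => s; rewrite /pairing big1 => [|p _]; last exact: hip0l.
by rewrite mulr0 sub0r oppr_le0 (pk_pos pK).
Qed.

Let rk_nsqZ_le a f : inrk f -> N (fun l => a *: f l) <= csq a * N f.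
Proof.
move=> f_in; apply: rk_nsq_le; apply/(rk_bound_csq pK); split=> [|s].
  by rewrite mulr_ge0 ?csq_ge0 ?rk_nsq_ge0.
by rewrite pairingZ csqM -mulrA; apply: ler_wpM2l; rewrite ?csq_ge0 ?csq_pairing_le.
Qed.

Lemma rk_nsqZ a f : inrk f -> N (fun l => a *: f l) = csq a * N f.
Proof.
move=> f_in; apply/eqP; rewrite eq_le rk_nsqZ_le //=.
have [->|an] := eqVneq a 0.
  by rewrite csq_real expr0n mul0r; apply: rk_nsq_ge0; apply: in_rkZ.
have <- : N (fun l => a^-1 *: (a *: f l)) = N f.
  by apply: eq_rk_nsq => l _; rewrite scalerA mulVf // scale1r.
apply: le_trans (ler_wpM2l (csq_ge0 a) (rk_nsqZ_le a^-1 (in_rkZ a f_in))) _.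
by rewrite mulrA -csqM divff // csq1 mul1r.
Qed.

Let rk_parallelogram_le f g : inrk f -> inrk g ->
  N (fun l => f l + g l) + N (fun l => f l - g l) <= 2 * N f + 2 * N g.
Proof.
move=> f_in g_in; rewrite -lerBrDr; apply: rk_nsq_le; apply/(rk_boundE pK) => s.
rewrite lerBrDr addrC -lerBrDr; apply: rk_nsq_le; apply/(rk_boundE pK) => t.
have := rk_nsq_ge (famZ (2^-1)%:C (s ++ t)) f_in.
have := rk_nsq_ge (famZ (2^-1)%:C (s ++ famZ (-1) t)) g_in.
rewrite !(kquad_famZ pK, kquad_cat pK, kform_famZr pK) pairingB pairingD.
rewrite !(pairing_famZ, pairing_cat) rmorphN1 conjc_real !mulN1r !Re_realM !(ReD, ReN).
by rewrite csqN csq1 csq_real; lra.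
Qed.

Lemma rk_parallelogram f g : inrk f -> inrk g ->
  N (fun l => f l + g l) + N (fun l => f l - g l) = 2 * N f + 2 * N g.
Proof.
move=> f_in g_in; apply/eqP; rewrite eq_le rk_parallelogram_le //=.
have N_double h k : inrk h -> (forall l, inball l -> k l = h l + h l) -> N k = 4 * N h.
  move=> h_in kE; have -> : N k = N (fun l => 2%:C *: h l).
    by apply: eq_rk_nsq => l bl; rewrite kE // rmorph_nat scaler_nat mulr2n.
  by rewrite rk_nsqZ // csq_real; ring.
have := rk_parallelogram_le (in_rkD f_in g_in) (in_rkB f_in g_in).
have -> : N (fun l => f l + g l + (f l - g l)) = 4 * N f.
  by apply: N_double => // l _; hilb_ring.
have -> : N (fun l => f l + g l - (f l - g l)) = 4 * N g.
  by apply: N_double => // l _; hilb_ring.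
by lra.
Qed.

Lemma in_rk_kspan t : inrk (kspan K t).
Proof.
exists (kquad K t); apply/(rk_bound_csq pK); split=> [|s]; first exact: (pk_pos pK).
by rewrite pairing_kspan kform_CauchySchwarz.
Qed.

Let rk_nsqD_kspan_le f t : inrk f ->
  N (fun l => f l + kspan K t l) <= N f + 2 * complex.Re (pairing f t) + kquad K t.
Proof.
move=> f_in; apply: rk_nsq_le; apply/(rk_boundE pK) => s.
have := rk_nsq_ge (s ++ famZ (-1) t) f_in.
rewrite pairingD pairing_kspan pairing_cat (kquad_cat pK) (kquad_famZ pK) (kform_famZr pK).
by rewrite pairing_famZ rmorphN1 !mulN1r csqN csq1 !(ReD, ReN); lra.
Qed.

Lemma rk_nsqD_kspan f t : inrk f ->
  N (fun l => f l + kspan K t l) = N f + 2 * complex.Re (pairing f t) + kquad K t.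
Proof.
move=> f_in; apply/eqP; rewrite eq_le rk_nsqD_kspan_le //=.
have := rk_nsqD_kspan_le (famZ (-1) t) (in_rkD f_in (in_rk_kspan t)).
have -> : N (fun l => f l + kspan K t l + kspan K (famZ (-1) t) l) = N f.
  by apply: eq_rk_nsq => l bl; rewrite kspan_famZ // scaleN1r addrK.
rewrite pairing_famZ (kquad_famZ pK) pairingD pairing_kspan rmorphN1 mulN1r csqN csq1.
by rewrite ReN ReD -/(kquad K t); lra.
Qed.

Lemma nsq_eval_le z : inball z -> exists2 M : R, 0 <= M &
  forall f, inrk f -> hnsq (f z) <= M * N f.
Proof.
move=> bz; have [M K_le] := pk_bounded pK bz; exists `|M| => [|f f_in]; first exact: normr_ge0.
apply: ler_of_sqr_le_mul; first by rewrite mulr_ge0 ?rk_nsq_ge0.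
have := csq_pairing_le [:: (exist _ z bz, f z)] f_in.
rewrite pairing1 hipxx csq_real /kquad kform1 /= => /le_trans; apply.
rewrite mulrAC mulrC; apply: ler_wpM2r; first exact: rk_nsq_ge0.
by apply: le_trans (K_le _) _; apply: ler_wpM2r; rewrite ?nsq_ge0 ?ler_norm.
Qed.

Lemma rk_bound_limit (u : nat -> pt R d -> Y) f c (n0 : nat) :
  (forall l, inball l -> ip_cvg (@hip R Y) (fun n => u n l) (f l)) ->
  (forall n, (n0 <= n)%N -> rk_bound (@hip R Y) K (u n) c) -> rk_bound (@hip R Y) K f c.
Proof.
move=> u_f u_le; apply/(rk_boundE pK) => s; apply/ler_addgt0Pr => e e0.
have [N f_le] := pairing_le_limit s u_f (divr_gt0 e0 (@ltr0Sn R 1)).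
have := f_le (maxn n0 N) (leq_maxr _ _).
by have := u_le _ (leq_maxl n0 N); move=> /(rk_boundE pK)/(_ s); lra.
Qed.

End KernelSpaceNorm.

Section ReproducingKernelHilbertSpace.
Variables (R : realType) (d : nat) (Y : hilb R) (K : pt R d -> pt R d -> Y -> Y).
Local Notation C := R[i].
Local Notation N := (rk_nsq (@hip R Y) K).
Local Notation inrk := (in_rk (@hip R Y) K).

(* [H] is H(K), its elements being represented as functions through [fn]; only their values
   on the ball matter. *)
Record is_rkhs (H : hilb R) (fn : H -> pt R d -> Y) : Prop := IsRKHS {
  rkhs_linear : forall l, linear (fun x => fn x l);
  rkhs_in_rk : forall x, inrk (fn x);
  rkhs_ext : forall x y, (forall l, inball l -> fn x l = fn y l) -> x = y;
  rkhs_surj : forall f, inrk f -> exists x, forall l, inball l -> fn x l = f l;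
  rkhs_hip : forall x y, hip x y = rk_ip (@hip R Y) K (fn x) (fn y);
  rkhs_nsq : forall x, hnsq x = N (fn x) }.

Hypothesis pK : pos_kernel K.

Section Model.

Let rk_submodule : submodule (pt R d -> Y).
Proof.
apply: (@SubModule _ (pt R d -> Y) (fun f => inrk f /\ forall l, ~ inball l -> f l = 0)).
  by split=> //; exact: in_rk0.
move=> a f g [f_in f0] [g_in g0]; split; first exact: in_rkD (in_rkZ pK a f_in) g_in.
by move=> l nbl; rewrite -[LHS]/(a *: f l + g l) f0 // g0 // scaler0 addr0.
Defined.

Local Notation V := (submod_type rk_submodule).

Let V_in (x : V) : inrk (submod_val x). Proof. by case: (submod_valP x). Qed.

Let NV (x : V) : R := N (submod_val x).

Let NV_ge0 x : 0 <= NV x. Proof. exact: (rk_nsq_ge0 pK (V_in x)). Qed.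

Let NVZ (a : C) x : NV (a *: x) = csq a * NV x. Proof. exact: (rk_nsqZ pK a (V_in x)). Qed.

Let NV_parallelogram x y : NV (x + y) + NV (x - y) = 2 * NV x + 2 * NV y.
Proof. exact: (rk_parallelogram pK (V_in x) (V_in y)). Qed.

Let ipV (x y : V) : C := rk_ip (@hip R Y) K (submod_val x) (submod_val y).

Let ipV_jvn x y : ipV x y = jvn NV x y.
Proof. by rewrite jvn_polarization. Qed.

Let ipV_lin (a : C) (x y z : V) : ipV (a *: x + y) z = a * ipV x z + ipV y z.
Proof. by rewrite !ipV_jvn; exact: (jvn_linl NV_ge0 NVZ NV_parallelogram). Qed.

Let ipV_sym (x y : V) : ipV y x = conjc (ipV x y).
Proof. by rewrite !ipV_jvn; exact: (jvn_sym NVZ). Qed.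

Let ipVxx (x : V) : ipV x x = (NV x)%:C.
Proof. by rewrite ipV_jvn; exact: (jvnxx NVZ). Qed.

Let nsq_ipV x : nsq ipV x = NV x.
Proof. by rewrite /nsq ipVxx. Qed.

Let ipV_pos (x : V) : 0 <= ipV x x.
Proof. by rewrite ipVxx ler0c. Qed.

Let V_ext (x y : V) : (forall l, inball l -> submod_val x l = submod_val y l) -> x = y.
Proof.
move=> xy; apply: val_inj; apply/funext => l; have [bl|nbl] := pselect (inball l).
  exact: xy.
by have [_ x0] := submod_valP x; have [_ y0] := submod_valP y; rewrite /= x0 // y0.
Qed.

Let ipV_def (x : V) : ipV x x = 0 -> x = 0.
Proof.
rewrite ipVxx => /(@complexI R) x0; apply: V_ext => l bl.
have [M _ /(_ _ (V_in x))] := nsq_eval_le pK bl.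
by rewrite -/(NV x) x0 mulr0; exact: nsq_le0.
Qed.

Let eval_cvg (u : nat -> V) l : ip_cauchy ipV u ->
  exists y, inball l -> ip_cvg (@hip R Y) (fun n => submod_val (u n) l) y.
Proof.
move=> cauchy_u; have [bl|nbl] := pselect (inball l); last by exists 0.
have [M M0 eval_le] := nsq_eval_le pK bl.
have [|y u_y] := @cauchy_ip_cvg R Y (fun n => submod_val (u n) l); last by exists y.
move=> e e0; have eM0 : 0 < e / (M + 1) by rewrite divr_gt0 //; lra.
have [n0 u_n0] := cauchy_u _ eM0; exists n0 => m n n0m n0n.
apply: le_lt_trans (eval_le _ (V_in (u m - u n))) _.
have := u_n0 m n n0m n0n; rewrite nsq_ipV ltr_pdivlMr; last by lra.
by have := NV_ge0 (u m - u n); rewrite /NV; lra.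
Qed.

Let ipV_complete (u : nat -> V) : ip_cauchy ipV u -> exists l, ip_cvg ipV u l.
Proof.
move=> cauchy_u; have /boolp.choice[f0 u_f0] l := eval_cvg l cauchy_u.
pose f l := if `[< inball l >] then f0 l else 0.
have fE l : inball l -> f l = f0 l by rewrite /f => /asboolP ->.
have tail e n0 : (forall m n, (n0 <= m)%N -> (n0 <= n)%N -> nsq ipV (u m - u n) < e) ->
    forall m, (n0 <= m)%N -> rk_bound (@hip R Y) K (fun l => submod_val (u m) l - f l) e.
  move=> u_e m n0m.
  apply: (rk_bound_limit pK (u := fun n l => submod_val (u m) l - submod_val (u n) l) (n0 := n0)).
    move=> l bl e' /(u_f0 l bl)[n1 u_n1]; exists n1 => n n1n.
    by rewrite opprB addrC addrA subrK -nsqN opprB fE // u_n1.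
  move=> n n0n; apply: (eq_rk_bound pK (f := submod_val (u m - u n))) => //.
  have := u_e m n n0m n0n; rewrite nsq_ipV => /ltW u_le.
  apply/(rk_boundE pK) => s; apply: le_trans u_le.
  exact: rk_nsq_ge (V_in _).
have f_in : inrk f.
  have [n0 u_n0] := cauchy_u 1 ltr01.
  have sub_in : inrk (fun l => submod_val (u n0) l - f l).
    by exists 1; exact: tail u_n0 _ (leqnn _).
  by apply: (eq_in_rk pK) (in_rkB pK (V_in (u n0)) sub_in) => l _; hilb_ring.
have Vf : submod_pred rk_submodule f.
  by split=> // l /asboolPn/negbTE nbl; rewrite /f nbl.
exists (submod_elt Vf) => e e0.
have [n0 u_n0] := cauchy_u (e / 2) ltac:(lra); exists n0 => n n0n.
rewrite nsq_ipV; apply: (@le_lt_trans _ _ (e / 2)); last by lra.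
by apply: rk_nsq_le; exact: tail u_n0 _ n0n.
Qed.

Let rkhs_model : hilb R := Hilb ipV_lin ipV_sym ipV_pos ipV_def ipV_complete.

Lemma rkhs_exists : exists (H : hilb R) (fn : H -> pt R d -> Y), is_rkhs fn.
Proof.
exists rkhs_model, (fun x => submod_val (x : V)); split.
- by [].
- exact: V_in.
- exact: V_ext.
- move=> f f_in; pose f' l := if `[< inball l >] then f l else 0.
  have f'E l : inball l -> f' l = f l by rewrite /f' => /asboolP ->.
  have Vf' : submod_pred rk_submodule f'.
    split; first by apply: (eq_in_rk pK) f_in => l bl; rewrite f'E.
    by move=> l /asboolPn/negbTE nbl; rewrite /f' nbl.
  by exists (submod_elt Vf').
- by [].
- exact: nsq_ipV.
Qed.

End Model.

Variables (H : hilb R) (fn : H -> pt R d -> Y).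
Hypothesis rkH : is_rkhs fn.

Definition rk_elt (f : pt R d -> Y) : H :=
  epsilon (inhabits 0) (fun x => forall l, inball l -> fn x l = f l).

Lemma rk_eltE f l : inrk f -> inball l -> fn (rk_elt f) l = f l.
Proof.
move=> f_in; exact: (epsilon_spec (inhabits 0) (fun x => forall l, inball l -> fn x l = f l)
  (rkhs_surj rkH f_in)).
Qed.

Lemma rk_elt_unique f x : (forall l, inball l -> fn x l = f l) -> rk_elt f = x.
Proof.
move=> xf; have f_in : inrk f by apply: (eq_in_rk pK) xf (rkhs_in_rk rkH x).
by apply: (rkhs_ext rkH) => l bl; rewrite rk_eltE // xf.
Qed.

Lemma rk_eltK : cancel fn rk_elt.
Proof. by move=> x; exact: rk_elt_unique. Qed.

Lemma rk_ip_elt f g : inrk f -> inrk g ->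
  rk_ip (@hip R Y) K f g = hip (rk_elt f) (rk_elt g).
Proof.
by move=> f_in g_in; rewrite (rkhs_hip rkH); apply: (eq_rk_ip pK) => l bl; rewrite rk_eltE.
Qed.

Lemma rk_nsq_elt f : inrk f -> hnsq (rk_elt f) = N f.
Proof. by move=> f_in; rewrite (rkhs_nsq rkH); apply: (eq_rk_nsq pK) => l; exact: rk_eltE. Qed.

Definition rk_ker (t : fam d Y) : H := rk_elt (kspan K t).

Lemma rk_kerE t l : inball l -> fn (rk_ker t) l = kspan K t l.
Proof. exact: rk_eltE (in_rk_kspan pK t). Qed.

Lemma rk_ker1E z y l : inball l -> fn (rk_ker [:: (z, y)]) l = K l (sval z) y.
Proof. by move=> bl; rewrite rk_kerE // kspan1. Qed.

Let rip_rk_ker x t : rip x (rk_ker t) = complex.Re (pairing (fn x) t).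
Proof.
have nsqD_ker z : hnsq (z + rk_ker t) = hnsq z + 2 * complex.Re (pairing (fn z) t) + kquad K t.
  rewrite !(rkhs_nsq rkH) -(rk_nsqD_kspan pK _ (rkhs_in_rk rkH z)).
  apply: (eq_rk_nsq pK) => l bl.
  by rewrite (linD (rkhs_linear rkH l)) rk_kerE.
have pairing0 : pairing (fn 0) t = 0.
  by apply: big1 => p _; rewrite (lin0 (rkhs_linear rkH _)) hip0l.
have := nsqD_ker 0; rewrite add0r pairing0 nsq0 /= mulr0 !add0r => nsq_ker.
by have := nsqD_ker x; rewrite nsqD nsq_ker; lra.
Qed.

Lemma rk_reproducing x t : hip x (rk_ker t) = pairing (fn x) t.
Proof.
apply: complex_ext_Re; first exact: rip_rk_ker.
have := rip_rk_ker ('i%C *: x) t; rewrite /rip hipZl => ->.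
rewrite -pairingZ; congr complex.Re; apply: eq_pairing => l _.
exact: linZ (rkhs_linear rkH l) _ _.
Qed.

Lemma rk_reproducing1 x z y : hip x (rk_ker [:: (z, y)]) = hip (fn x (sval z)) y.
Proof. by rewrite rk_reproducing pairing1. Qed.

Lemma rk_ker1_linear z : linear (fun y => rk_ker [:: (z, y)]).
Proof.
move=> a y y'; apply: (rkhs_ext rkH) => l bl.
by rewrite (rkhs_linear rkH) !rk_ker1E // (pk_linear pK bl (svalP z)).
Qed.

Lemma hip_rk_ker1 z y z' y' :
  hip (rk_ker [:: (z, y)]) (rk_ker [:: (z', y')]) = hip (K (sval z') (sval z) y) y'.
Proof. by rewrite rk_reproducing1 rk_ker1E //; exact: svalP. Qed.

End ReproducingKernelHilbertSpace.

(* The defect form is the kernel of a reproducing kernel Hilbert space over the ball of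
   [C ^ 0], a single point. *)
Lemma defect_operator (R : realType) (G X : hilb R) (W : G -> X) : contraction W ->
  exists (F : hilb R) (tau : G -> F), contraction tau /\
    forall g g', hip (tau g) (tau g') = hip g g' - hip (W g) (W g').
Proof.
move=> contrW; have bW := contraction_bop contrW.
pose K (l z : pt R 0) (y : G) : G := y - hadj W (W y).
have KE l z y y' : hip (K l z y) y' = hip y y' - hip (W y) (W y').
  by rewrite hipBl -(adjP_sym bW).
have linK l z : linear (K l z).
  by move=> a y y'; rewrite /K contrW.1 (adj_linear bW); hilb_ring.
have pK : pos_kernel K.
  split=> [//|l z y y' _ _|s|z _].
  - by rewrite !KE rmorphB /= -!hip_sym.
  - have -> : kquad K s = complex.Re (hip (K pt0 pt0 (\sum_(p <- s) p.2)) (\sum_(p <- s) p.2)).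
      rewrite /kquad /kform hip_sumr; congr complex.Re; apply: eq_bigr => p _.
      by rewrite (lin_sum (linK _ _)) hip_suml.
    by rewrite KE ReB subr_ge0; exact: contrW.2.
  - by exists 1 => y; rewrite KE ReB mul1r lerBlDr lerDl; exact: nsq_ge0.
have [F [fn rkF]] := rkhs_exists pK.
pose z0 : bpt R 0 := exist _ pt0 (inball0 R 0).
pose tau g := rk_ker K fn [:: (z0, g)].
have tauE g g' : hip (tau g) (tau g') = hip g g' - hip (W g) (W g').
  by rewrite /tau (hip_rk_ker1 pK rkF) KE.
exists F, tau; split=> //; split; first exact: (rk_ker1_linear pK rkF).
by move=> g; rewrite /nsq tauE ReB lerBlDr lerDl; exact: nsq_ge0.
Qed.

(** * The Drury-Arveson space *)

Section BallKernel.
Variables (R : realType) (d : nat).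
Implicit Types l z : pt R d.

Lemma dotC_sym l z : dotC z l = conjc (dotC l z).
Proof.
rewrite !dotCE rmorph_sum; apply: eq_bigr => j _.
by rewrite rmorphM /= conjcK mulrC.
Qed.

Lemma Re_dotC_le l z : 2 * complex.Re (dotC l z) <= psq l + psq z.
Proof.
rewrite dotCE Re_sum mulr_sumr -big_split /=; apply: ler_sum => j _.
case: (l j) => a b; case: (z j) => a' b'; rewrite /csq /=.
by have := sqr_ge0 (a - a'); have := sqr_ge0 (b - b'); nra.
Qed.

Lemma kdK l z : inball l -> inball z -> kd l z * (1 - dotC l z) = 1.
Proof.
move=> /inballE bl /inballE bz; rewrite /kd mulVf //; apply/eqP => dotC1.
have := congr1 (@complex.Re R) dotC1; rewrite ReB /=.
by have := Re_dotC_le l z; lra.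
Qed.

Lemma kd_rec l z : inball l -> inball z -> kd l z = 1 + dotC l z * kd l z.
Proof. by move=> bl bz; rewrite -[X in _ = X + _](kdK bl bz); ring. Qed.

Lemma kd_sym l z : kd z l = conjc (kd l z).
Proof. by rewrite /kd dotC_sym conjc_inv rmorphB rmorph1. Qed.

Lemma kd0 l : kd l pt0 = 1.
Proof.
rewrite /kd dotCE big1 ?subr0 ?invr1 // => j _.
by rewrite /pt0 conjc0 mulr0.
Qed.

End BallKernel.

(* The least [c] with [- c E <= F] satisfies [c <= rho c]. *)
Lemma ge0_of_contractive_minorant (R : realType) (d : nat) (T : Type)
    (sh : 'I_d -> T -> T) (F E : T -> R) (rho B : R) : rho < 1 -> 0 <= B ->
  (forall x, 0 <= E x) ->
  (forall x, \sum_(j < d) E (sh j x) <= rho * E x) ->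
  (forall x, \sum_(j < d) F (sh j x) <= F x) ->
  (forall x, - (B * E x) <= F x) ->
  forall x, 0 <= F x.
Proof.
move=> rho1 B0 E0 E_sh F_sh F_ge x.
pose minorant : set R := [set c | 0 <= c /\ forall x, - (c * E x) <= F x]%classic.
have has_inf_minorant : has_inf minorant by split; [exists B | exists 0 => c []].
pose m := inf minorant.
have m0 : 0 <= m by apply: lb_le_inf; [exact: has_inf_minorant.1 | move=> c []].
have minorant_m : minorant m.
  split=> // z; rewrite lerNl; apply: (@ler_add_gt0_mul _ _ _ (E z)) => e e0.
  have [c [_ /(_ z) c_le] c_lt] := inf_adherent e0 has_inf_minorant.
  have : c * E z <= (m + e) * E z by apply: ler_wpM2r; [exact: E0 | exact: ltW].
  by rewrite mulrDl; lra.
have m_le : m <= Num.max 0 (rho * m).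
  apply: ge_inf; first exact: has_inf_minorant.2.
  split=> [|z]; first by rewrite le_max lexx.
  apply: le_trans (F_sh z); rewrite lerNl -sumrN.
  apply: (@le_trans _ _ (\sum_(j < d) m * E (sh j z))).
    by apply: ler_sum => j _; rewrite lerNl minorant_m.2.
  rewrite -mulr_sumr; apply: le_trans (ler_wpM2l m0 (E_sh z)) _.
  by rewrite mulrA [m * rho]mulrC; apply: ler_wpM2r; rewrite ?E0 // le_max lexx orbT.
have m_eq0 : m = 0.
  apply/eqP; rewrite eq_le m0 andbT; move: m_le; rewrite le_max => /orP[//|m_le].
  by rewrite -(@pmulr_rle0 _ (1 - rho)) ?subr_gt0 // mulrBl mul1r subr_le0.
by have := minorant_m.2 x; rewrite m_eq0 mul0r oppr0.
Qed.

Lemma rip_form_ge (R : realType) (H : hilb R) (I : finType) (c : I -> I -> R[i]) (y : I -> H) :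
  - ((\sum_i \sum_k (csq (c i k) + 1)) * \sum_i hnsq (y i)) <=
  \sum_i \sum_k rip (c i k *: y k) (y i).
Proof.
set E := \sum_i hnsq _.
have E0 : 0 <= E by apply: sumr_ge0 => i _; exact: nsq_ge0.
have nsq_le_E i : hnsq (y i) <= E.
  by rewrite /E (bigD1 i) //= lerDl sumr_ge0 // => k _; exact: nsq_ge0.
rewrite mulr_suml -sumrN; apply: ler_sum => i _; rewrite mulr_suml -sumrN.
apply: ler_sum => k _; have := nsq_ge0 (c i k *: y k + y i); rewrite nsqD nsqZ.
have c0 := csq_ge0 (c i k); have := mulr_ge0 c0 (nsq_ge0 (y k)); have := nsq_ge0 (y i).
by have := nsq_le_E i; have := ler_wpM2l c0 (nsq_le_E k); lra.
Qed.

Section DruryArvesonKernel.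
Variables (R : realType) (d : nat) (Y : hilb R).
Local Notation C := R[i].
Local Notation K := (@kdI R d Y).
Implicit Types s t : fam d Y.

Definition fam_shift (j : 'I_d) s : fam d Y :=
  [seq (p.1, conjc (sval p.1 j) *: p.2) | p <- s].

Lemma kform_kd_rec s t : kform K s t =
  hip (\sum_(p <- t) p.2) (\sum_(p <- s) p.2) +
  \sum_(j < d) kform K (fam_shift j s) (fam_shift j t).
Proof.
rewrite /kform hip_sumr.
under [X in _ = _ + X]eq_bigr => j _ do rewrite big_map.
rewrite [X in _ = _ + X]exchange_big /= -big_split; apply: eq_bigr => p _ /=.
under [X in _ = _ + X]eq_bigr => j _ do rewrite big_map.
rewrite [X in _ = _ + X]exchange_big /= hip_suml -big_split; apply: eq_bigr => p' _ /=.
under [X in _ = _ + X]eq_bigr => j _ do rewrite /kdI !hipZl hipZr conjcK.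
rewrite /kdI hipZl {1}(kd_rec (svalP p.1) (svalP p'.1)) mulrDl mul1r; congr (_ + _).
by rewrite dotCE !mulr_suml; apply: eq_bigr => j _; ring.
Qed.

Lemma kquad_shift_le s : \sum_(j < d) kquad K (fam_shift j s) <= kquad K s.
Proof. by rewrite /kquad kform_kd_rec ReD Re_sum lerDr nsq_ge0. Qed.

(* [fam_shift] shrinks the vectors by the norms of the points, while [kquad] dominates the
   sum of its shifts. *)
Lemma kquad_kd_ge0 s : 0 <= kquad K s.
Proof.
pose z i := (tnth (in_tuple s) i).1; pose lz i := sval (z i).
pose famz (y : 'I_(size s) -> Y) : fam d Y := [seq (z i, y i) | i <- enum 'I_(size s)].
have -> : s = famz (fun i => (tnth (in_tuple s) i).2).
  rewrite -[LHS](map_tnth_enum (in_tuple s)); apply: eq_map => i.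
  exact: surjective_pairing.
pose E (y : 'I_(size s) -> Y) := \sum_i hnsq (y i).
have E0 y : 0 <= E y by apply: sumr_ge0 => i _; exact: nsq_ge0.
pose rho := \big[Num.max/0]_i psq (lz i).
have rho1 : rho < 1.
  rewrite /rho; elim/big_ind: _ => // [x y x1 y1|i _]; first by rewrite gt_max x1 y1.
  exact/inballE/svalP.
pose sh j (y : 'I_(size s) -> Y) i := conjc (lz i j) *: y i.
have famz_sh j y : famz (sh j y) = fam_shift j (famz y).
  by rewrite /fam_shift /famz -[RHS]map_comp.
have E_sh y : \sum_(j < d) E (sh j y) <= rho * E y.
  rewrite /E exchange_big /= mulr_sumr; apply: ler_sum => i _.
  under eq_bigr do rewrite nsqZ csqJ.
  rewrite -mulr_suml; apply: ler_wpM2r; first exact: nsq_ge0.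
  exact: (@le_bigmax _ _ _ _ (fun i => psq (lz i))).
have kquad_sh y : \sum_(j < d) kquad K (famz (sh j y)) <= kquad K (famz y).
  by under eq_bigr do rewrite famz_sh; exact: kquad_shift_le.
pose B : R := \sum_i \sum_k (csq (kd (lz i) (lz k)) + 1).
have B0 : 0 <= B by do 2!(apply: sumr_ge0 => ? _); rewrite addr_ge0 ?csq_ge0.
have kquad_ge y : - (B * E y) <= kquad K (famz y).
  apply: le_trans (rip_form_ge (fun i k => kd (lz i) (lz k)) y) _; rewrite le_eqVlt.
  apply/orP; left; apply/eqP; rewrite /kquad /kform big_map enumT Re_sum.
  by apply: eq_bigr => i _; rewrite big_map enumT Re_sum.
exact: (ge0_of_contractive_minorant rho1 B0 E0 E_sh kquad_sh kquad_ge).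
Qed.

Lemma pos_kernel_kd : pos_kernel K.
Proof.
split=> [l z _ _ a x y|l z y y' _ _|s|z _].
- by rewrite /kdI scalerDr !scalerA mulrC.
- by rewrite /kdI !hipZl kd_sym rmorphM /= -hip_sym.
- exact: kquad_kd_ge0.
- by exists (complex.Re (kd z z)) => y; rewrite /kdI hipZl hipxx mulrC Re_realM mulrC.
Qed.

Local Notation inrk := (in_rk (@hip R Y) K).
Local Notation N := (rk_nsq (@hip R Y) K).

Lemma pairing_shift (f : pt R d -> Y) j s :
  pairing (fun l => l j *: f l) s = pairing f (fam_shift j s).
Proof. by rewrite /pairing big_map; apply: eq_bigr => p _; rewrite hipZl hipZr conjcK. Qed.

Lemma rk_bound_shift_row (h : 'I_d -> pt R d -> Y) : (forall j, inrk (h j)) ->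
  rk_bound (@hip R Y) K (fun l => \sum_(j < d) l j *: h j l) (\sum_(j < d) N (h j)).
Proof.
move=> h_in; apply/(rk_boundE pos_kernel_kd) => s.
have -> : pairing (fun l => \sum_(j < d) l j *: h j l) s =
    \sum_(j < d) pairing (h j) (fam_shift j s).
  under [RHS]eq_bigr do rewrite -pairing_shift.
  by rewrite /pairing exchange_big; apply: eq_bigr => p _; rewrite hip_suml.
have := kquad_shift_le s; rewrite Re_sum mulr_sumr => le_kquad.
apply: (@le_trans _ _ (\sum_(j < d) 2 * complex.Re (pairing (h j) (fam_shift j s)) -
  \sum_(j < d) kquad K (fam_shift j s))); first by rewrite lerB.
by rewrite -sumrB; apply: ler_sum => j _; exact: (rk_nsq_ge pos_kernel_kd).
Qed.

Lemma rk_bound_shift j f : inrk f -> rk_bound (@hip R Y) K (fun l => l j *: f l) (N f).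
Proof.
move=> f_in; apply/(rk_boundE pos_kernel_kd) => s; rewrite pairing_shift.
apply: le_trans (rk_nsq_ge pos_kernel_kd (fam_shift j s) f_in); rewrite lerD2l lerN2.
apply: le_trans (kquad_shift_le s); rewrite (bigD1 j) //= lerDl.
by apply: sumr_ge0 => i _; exact: kquad_kd_ge0.
Qed.

Lemma in_rk_shift j f : inrk f -> inrk (fun l => l j *: f l).
Proof. by move=> f_in; exists (N f); exact: rk_bound_shift. Qed.

Section BackwardShift.
Variables (H : hilb R) (fn : H -> pt R d -> Y).
Hypothesis rkH : is_rkhs K fn.
Let pkd := pos_kernel_kd.

Definition shift (j : 'I_d) (x : H) : H := rk_elt fn (fun l => l j *: fn x l).

Definition bshift (j : 'I_d) : H -> H := hadj (shift j).

Lemma shiftE j x l : inball l -> fn (shift j x) l = l j *: fn x l.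
Proof. by apply: (rk_eltE rkH); exact: in_rk_shift (rkhs_in_rk rkH x). Qed.

Lemma contraction_shift j : contraction (shift j).
Proof.
split=> [a x y|x].
  apply: (rkhs_ext rkH) => l bl.
  by rewrite (rkhs_linear rkH) !shiftE // (rkhs_linear rkH) scalerDr !scalerA mulrC.
rewrite (rk_nsq_elt pkd rkH); last exact: in_rk_shift (rkhs_in_rk rkH x).
by rewrite (rkhs_nsq rkH); apply: rk_nsq_le; exact: rk_bound_shift (rkhs_in_rk rkH x).
Qed.

Lemma hip_shift j x y : hip (shift j x) y = hip x (bshift j y).
Proof. exact: adjP (contraction_bop (contraction_shift j)) _ _. Qed.

Lemma bshift_comm i j x : bshift i (bshift j x) = bshift j (bshift i x).
Proof.
apply: hip_ext => y; rewrite -!hip_shift; congr (hip _ _); apply: (rkhs_ext rkH) => l bl.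
by rewrite !shiftE // !scalerA mulrC.
Qed.

(* The row [shift] is a contraction, hence so is the column of adjoints. *)
Lemma column_contraction_bshift : column_contraction bshift.
Proof.
split=> [j|x]; first exact: (contraction_adj (contraction_shift j)).1.
pose v : H := \sum_(j < d) shift j (bshift j x); set T := \sum_(j < d) _.
have rip_v : rip v x = T.
  by rewrite /rip hip_suml Re_sum; apply: eq_bigr => j _; rewrite hip_shift.
have nsq_v : hnsq v <= T.
  rewrite (rkhs_nsq rkH); apply: rk_nsq_le.
  have := rk_bound_shift_row (fun j => rkhs_in_rk rkH (bshift j x)).
  under eq_bigr do rewrite -(rkhs_nsq rkH).
  apply: (eq_rk_bound pkd) => l bl; rewrite (lin_sum (rkhs_linear rkH l)).
  by apply: eq_bigr => j _; rewrite shiftE.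
apply: ler_of_sqr_le_mul; first exact: nsq_ge0.
rewrite -{1}rip_v [_ * T]mulrC; apply: le_trans (rip_CauchySchwarz v x) _.
by apply: ler_wpM2r; first exact: nsq_ge0.
Qed.

Lemma bshift_gleason x z : inball z ->
  fn x z - fn x pt0 = \sum_(j < d) z j *: fn (bshift j x) z.
Proof.
move=> bz; pose zb : bpt R d := exist _ z bz; pose b0 : bpt R d := exist _ pt0 (inball0 R d).
pose ker p := rk_ker K fn [:: p].
suff ker_gleason y : ker (zb, y) - ker (b0, y) =
    \sum_(j < d) conjc (z j) *: shift j (ker (zb, y)).
  apply: hip_ext => y; rewrite hip_sym [RHS]hip_sym; congr conjc.
  rewrite hipBl -(rk_reproducing1 pkd rkH x zb) -(rk_reproducing1 pkd rkH x b0) -hipBr.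
  rewrite ker_gleason hip_sumr hip_suml; apply: eq_bigr => j _.
  by rewrite hipZl hipZr conjcK -(rk_reproducing1 pkd rkH _ zb) hip_sym hip_shift -hip_sym.
apply: (rkhs_ext rkH) => l bl.
rewrite (linB (rkhs_linear rkH l)) (lin_sum (rkhs_linear rkH l)) !(rk_ker1E pkd rkH) //.
under eq_bigr do rewrite (linZ (rkhs_linear rkH l)) shiftE // (rk_ker1E pkd rkH) // !scalerA.
under eq_bigr do rewrite [conjc _ * _]mulrC.
rewrite -scaler_suml -mulr_suml -dotCE /kdI /= kd0 {1}(kd_rec bl bz) scalerDl.
by hilb_ring.
Qed.

Lemma obs_bshift l x : inball l -> obs bshift (fun y => fn y pt0) l x = fn x l.
Proof.
exact: obs_of_gleason column_contraction_bshift (rkhs_linear rkH) bshift_gleason l x.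
Qed.

Lemma is_Mstar_bshift j f : inrk f -> is_Mstar (@hip R Y) j f (fn (bshift j (rk_elt fn f))).
Proof.
move=> f_in; split=> [|h h_in]; first exact: (rkhs_in_rk rkH).
rewrite (rk_ip_elt pkd rkH (in_rk_shift j h_in) f_in).
rewrite (rk_ip_elt pkd rkH h_in (rkhs_in_rk rkH _)) (rk_eltK pkd rkH).
rewrite -hip_shift; congr (hip _ _); apply: (rk_elt_unique pkd rkH) => l bl.
by rewrite shiftE // (rk_eltE rkH h_in bl).
Qed.

Lemma MstarE j f l : inrk f -> inball l ->
  Mstar (@hip R Y) j f l = fn (bshift j (rk_elt fn f)) l.
Proof.
move=> f_in bl; have is_b := is_Mstar_bshift j f_in.
have [Mf_in MfP] : is_Mstar (@hip R Y) j f (Mstar (@hip R Y) j f).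
  exact: (epsilon_spec (inhabits (fun _ => 0 : Y)) (is_Mstar (@hip R Y) j f) (ex_intro _ _ is_b)).
rewrite -(rk_eltE rkH Mf_in bl); congr (fn _ _); apply: hip_ext => y.
have y_in := rkhs_in_rk rkH y; have := MfP _ y_in; rewrite is_b.2 //.
rewrite !(rk_ip_elt pkd rkH) //; last exact: (rkhs_in_rk rkH).
by rewrite !(rk_eltK pkd rkH) => ->.
Qed.

End BackwardShift.

Local Notation M := (@Mstar R d Y (@hip R Y)).
Implicit Types f g : pt R d -> Y.

Lemma Mstar_in_rk j f : inrk f -> inrk (M j f).
Proof.
have [H [fn rkH]] := rkhs_exists pos_kernel_kd.
move=> f_in; apply: (eq_in_rk pos_kernel_kd) (rkhs_in_rk rkH (bshift fn j (rk_elt fn f))) => l bl.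
by rewrite (MstarE rkH).
Qed.

Lemma eq_Mstar j f g l : inrk f -> (forall z, inball z -> f z = g z) -> inball l ->
  M j f l = M j g l.
Proof.
have [H [fn rkH]] := rkhs_exists pos_kernel_kd.
move=> f_in fg bl; have g_in := eq_in_rk pos_kernel_kd fg f_in.
rewrite !(MstarE rkH) //; congr (fn (bshift fn j _) l).
by apply: (rk_elt_unique pos_kernel_kd rkH) => z bz; rewrite (rk_eltE rkH) // fg.
Qed.

Lemma Mstar_linear j (a : C) f g l : inrk f -> inrk g -> inball l ->
  M j (fun z => a *: f z + g z) l = a *: M j f l + M j g l.
Proof.
have [H [fn rkH]] := rkhs_exists pos_kernel_kd.
move=> f_in g_in bl; have fg_in := in_rkD pos_kernel_kd (in_rkZ pos_kernel_kd a f_in) g_in.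
rewrite !(MstarE rkH) // -(rkhs_linear rkH) -(column_contraction_bshift rkH).1.
congr (fn (bshift fn j _) l); apply: (rk_elt_unique pos_kernel_kd rkH) => z bz.
by rewrite (rkhs_linear rkH) !(rk_eltE rkH).
Qed.

Lemma Mstar_comm i j f l : inrk f -> inball l -> M i (M j f) l = M j (M i f) l.
Proof.
have [H [fn rkH]] := rkhs_exists pos_kernel_kd.
move=> f_in bl; have elt_M k : rk_elt fn (M k f) = bshift fn k (rk_elt fn f).
  by apply: (rk_elt_unique pos_kernel_kd rkH) => z bz; rewrite (MstarE rkH).
have M_in k : inrk (M k f) by exact: Mstar_in_rk.
rewrite [LHS](MstarE rkH _ (M_in j) bl) [RHS](MstarE rkH _ (M_in i) bl) !elt_M.
by rewrite (bshift_comm rkH).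
Qed.

Lemma Mstar_gleason f z : inrk f -> inball z ->
  f z - f pt0 = \sum_(j < d) z j *: M j f z.
Proof.
have [H [fn rkH]] := rkhs_exists pos_kernel_kd.
move=> f_in bz; rewrite -!(rk_eltE rkH f_in) //; last exact: inball0.
by rewrite (bshift_gleason rkH) //; apply: eq_bigr => j _; rewrite (MstarE rkH).
Qed.

Lemma Mstar_obs (X : hilb R) (A : 'I_d -> X -> X) (Cc : X -> Y) f x j l :
  column_contraction A -> hbop Cc -> (forall i k y, A i (A k y) = A k (A i y)) ->
  inrk f -> (forall z, inball z -> f z = obs A Cc z x) -> inball l ->
  M j f l = obs A Cc l (A j x).
Proof.
have [H [fn rkH]] := rkhs_exists pos_kernel_kd.
move=> contrA bC commA f_in f_obs bl.
have b_eval0 : hbop (fun y => fn y pt0).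
  split; first exact: (rkhs_linear rkH).
  have [c _ eval_le] := nsq_eval_le pos_kernel_kd (inball0 R d).
  by exists c => y; rewrite (rkhs_nsq rkH); exact: eval_le (rkhs_in_rk rkH y).
rewrite (MstarE rkH) // -(obs_bshift rkH) //.
have contr_b := column_contraction_bshift rkH; have comm_b := bshift_comm rkH.
apply: (obs_eq_invariant contr_b b_eval0 comm_b contrA bC commA) => //.
by move=> z bz; rewrite (obs_bshift rkH) // (rk_eltE rkH) ?f_obs.
Qed.

End DruryArvesonKernel.

(** * De Branges-Rovnyak spaces and colligations *)

Section DeBrangesRovnyak.
Variables (R : realType) (d : nat) (U Y : hilb R) (S : pt R d -> U -> Y).
Hypothesis bS : forall l, inball l -> hbop (S l).
Local Notation KSS := (KS (@hip R U) (@hip R Y) S).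
Local Notation kdY := (@kdI R d Y).
Local Notation kdU := (@kdI R d U).
Let pkdY := pos_kernel_kd d Y.
Let pkdU := pos_kernel_kd d U.

Lemma hip_KS l z y y' : inball l ->
  hip (KSS l z y) y' = kd l z * (hip y y' - hip (hadj (S z) y) (hadj (S l) y')).
Proof. by move=> bl; rewrite /KS hipZl hipBl (adjP (bS bl)). Qed.

Definition fam_adj (s : fam d Y) : fam d U :=
  [seq (p.1, hadj (S (sval p.1)) p.2) | p <- s].

Lemma pairing_mult (f : pt R d -> U) s : pairing (fun l => S l (f l)) s = pairing f (fam_adj s).
Proof.
by rewrite /pairing big_map; apply: eq_bigr => p _; rewrite (adjP (bS (svalP p.1))).
Qed.

Lemma kform_KS s t : kform KSS s t = kform kdY s t - kform kdU (fam_adj s) (fam_adj t).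
Proof.
rewrite /kform big_map -sumrB; apply: eq_bigr => p _; rewrite big_map -sumrB.
apply: eq_bigr => p' _ /=; rewrite hip_KS; last exact: svalP.
by rewrite /kdI !hipZl mulrBr.
Qed.

Lemma kquad_KS s : kquad KSS s = kquad kdY s - kquad kdU (fam_adj s).
Proof. by rewrite /kquad kform_KS ReB. Qed.

(* [fam_adj] is the action of the adjoint of the multiplier on kernel functions. *)
Lemma mult_contrP : mult_contr (@hip R U) (@hip R Y) S <->
  forall s, kquad kdU (fam_adj s) <= kquad kdY s.
Proof.
split=> [contrS s|adj_le f f_in].
  set t := fam_adj s; have [Sk_in Sk_le] := contrS _ (in_rk_kspan pkdU t).
  have k_le : rk_nsq (@hip R U) kdU (kspan kdU t) <= kquad kdU t.
    apply: rk_nsq_le; apply/(rk_bound_csq pkdU); split=> [|s']; first exact: (pk_pos pkdU).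
    by rewrite pairing_kspan kform_CauchySchwarz.
  apply: ler_of_sqr_le_mul; first exact: (pk_pos pkdY).
  have := csq_pairing_le pkdY s Sk_in.
  rewrite pairing_mult pairing_kspan (kformxx pkdU) csq_real -/t => /le_trans; apply.
  rewrite mulrC; apply: ler_wpM2l; first exact: (pk_pos pkdY).
  exact: le_trans Sk_le k_le.
have Sf_le : rk_bound (@hip R Y) kdY (fun l => S l (f l)) (rk_nsq (@hip R U) kdU f).
  apply/(rk_boundE pkdY) => s; rewrite pairing_mult.
  by have := rk_nsq_ge pkdU (fam_adj s) f_in; have := adj_le s; lra.
by split; [exists (rk_nsq (@hip R U) kdU f) | exact: rk_nsq_le].
Qed.

Hypothesis contrS : mult_contr (@hip R U) (@hip R Y) S.

Lemma pos_kernel_KS : pos_kernel KSS.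
Proof.
have adj_le := mult_contrP.1 contrS.
split=> [l z bl bz a x y|l z y y' bl bz|s|z bz].
- by rewrite /KS (adj_linear (bS bz)) (bS bl).1; hilb_ring.
- by rewrite !hip_KS // kd_sym rmorphM rmorphB /= -!hip_sym.
- by rewrite kquad_KS subr_ge0.
have [M kd_le] := pk_bounded pkdY bz; exists M => y; apply: le_trans (kd_le y).
have : kquad KSS [:: (exist _ z bz, y)] <= kquad kdY [:: (exist _ z bz, y)].
  by rewrite kquad_KS lerBlDr lerDl (pk_pos pkdU).
by rewrite /kquad !kform1.
Qed.

Lemma in_rk_KS_kd f : in_rk (@hip R Y) KSS f -> in_rk (@hip R Y) kdY f.
Proof.
move=> [c /(rk_boundE pos_kernel_KS) f_le]; exists c; apply/(rk_boundE pkdY) => s.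
by have := f_le s; rewrite kquad_KS; have := pk_pos pkdU (fam_adj s); lra.
Qed.

End DeBrangesRovnyak.

Section Colligation.
Variables (R : realType) (d : nat) (X U Y : hilb R).
Variable V : hprod X U -> hprod (hpow d X) Y.
Implicit Types (x : X) (u : U) (l z : pt R d).

Definition colA j x : X := (V (x, 0)).1 j.
Definition colB j u : X := (V (0, u)).1 j.
Definition colC x : Y := (V (x, 0)).2.
Definition colD u : Y := (V (0, u)).2.

Definition transfer l u : Y := colD u + obs colA colC l (rowop colB l u).

Definition realizes (S : pt R d -> U -> Y) : Prop :=
  forall l u, inball l -> S l u = transfer l u.

Lemma colligation_blocks x u : linear V ->
  V (x, u) = ([ffun j => colA j x + colB j u], colC x + colD u).
Proof.
move=> linV; have -> : ((x, u) : hprod X U) = ((x, 0) : hprod X U) + (0, u).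
  by apply: injective_projections => /=; rewrite ?addr0 ?add0r.
by rewrite (linD linV); apply: injective_projections.
Qed.

Hypothesis bV : hbop V.

Let bop_fst_coord j : hbop (fun p => (V p).1 j).
Proof.
apply: (bop_comp bV (T' := fun q : hprod (hpow d X) Y => q.1 j)).
apply: (bop_comp (contraction_bop (contraction_fst _ _)) (T' := fun q : hpow d X => q j)).
exact: contraction_bop (contraction_coord X j).
Qed.

Let bop_snd : hbop (fun p => (V p).2).
Proof.
apply: (bop_comp bV (T' := fun q : hprod (hpow d X) Y => q.2)).
exact: contraction_bop (contraction_snd _ _).
Qed.

Lemma bop_colA j : hbop (colA j).
Proof. exact: bop_comp (contraction_bop (contraction_inl X U)) (bop_fst_coord j). Qed.

Lemma bop_colB j : hbop (colB j).
Proof. exact: bop_comp (contraction_bop (contraction_inr X U)) (bop_fst_coord j). Qed.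

Lemma bop_colC : hbop colC.
Proof. exact: bop_comp (contraction_bop (contraction_inl X U)) bop_snd. Qed.

Lemma bop_colD : hbop colD.
Proof. exact: bop_comp (contraction_bop (contraction_inr X U)) bop_snd. Qed.

End Colligation.

Section ContractiveColligation.
Variables (R : realType) (d : nat) (X U Y : hilb R).
Variables (V : hprod X U -> hprod (hpow d X) Y) (S : pt R d -> U -> Y).
Hypothesis contrV : contraction V.
Hypothesis realS : realizes V S.
Implicit Types (x : X) (u : U) (l z : pt R d).

Local Notation A := (colA V).
Local Notation B := (colB V).
Local Notation Cc := (colC V).
Local Notation D := (colD V).
Let bV : hbop V := contraction_bop contrV.
Let bC : hbop Cc := bop_colC bV.

Lemma colligation_nsq_le x u :
  \sum_(j < d) hnsq (A j x + B j u) + hnsq (Cc x + D u) <= hnsq x + hnsq u.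
Proof.
have := contrV.2 (x, u); rewrite !nsq_prod nsq_pow colligation_blocks; last exact: contrV.1.
by under eq_bigr do rewrite ffunE.
Qed.

Lemma colAC_nsq_le x : \sum_(j < d) hnsq (A j x) + hnsq (Cc x) <= hnsq x.
Proof.
have := colligation_nsq_le x 0; rewrite nsq0 addr0 (lin0 (bop_colD bV).1) addr0.
by under eq_bigr do rewrite (lin0 (bop_colB bV _).1) addr0.
Qed.

Lemma column_contraction_colA : column_contraction A.
Proof.
split=> [j|x]; first exact: (bop_colA bV j).1.
by apply: le_trans (colAC_nsq_le x); rewrite lerDl nsq_ge0.
Qed.

Let contrA := column_contraction_colA.

Lemma realizes_bop l : inball l -> hbop (S l).
Proof.
move=> bl; have -> : S l = transfer V l by apply/funext => u; exact: realS.
apply: bopD; first exact: bop_colD.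
by apply: bop_comp (obs_bop contrA bC bl); apply: rowop_bop => j; exact: bop_colB.
Qed.

Let state l u : X := res A l (rowop B l u).

Let velocity l j u : X := A j (state l u) + B j u.

Let bop_velocity l j : inball l -> hbop (velocity l j).
Proof.
move=> bl; apply: bopD; last exact: bop_colB.
apply: (bop_comp (T := state l)) (bop_colA bV j); apply: bop_comp (res_bop contrA bl).
by apply: rowop_bop => i; exact: bop_colB.
Qed.

Let realizes_sub l z u : inball l -> inball z ->
  S l u - S z u = obs A Cc l (rowop (velocity z) (ptsub l z) u).
Proof.
move=> bl bz; rewrite !realS // /transfer opprD addrACA subrr add0r /obs -(linB bC.1).
congr (Cc _); apply/esym/(res_unique contrA) => //.
rewrite (linB (pencil_linear contrA l)) (resK contrA) // /pencil -/(state z u).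
have -> : rowop (velocity z) (ptsub l z) u =
    rowop A l (state z u) - rowop A z (state z u) + (rowop B l u - rowop B z u).
  rewrite -!rowop_sub /rowop -big_split /=; apply: eq_bigr => j _.
  exact: scalerDr.
by rewrite {2}/state (rowop_res contrA) //; hilb_ring.
Qed.

Lemma realizes_holo : holo (@hip R U) (@hip R Y) S.
Proof.
move=> z bz; have /inballE z1 := bz; pose rho := (1 + psq z) / 2.
have rho1 : rho < 1 by rewrite /rho; lra.
have z_rho : psq z <= rho by rewrite /rho; lra.
exists (fun j u => obs A Cc z (velocity z j u)); split=> [j|e e0].
  exact: bop_comp (bop_velocity j bz) (obs_bop contrA bC bz).
have [K K0 obs_le] := obs_lipschitz contrA bC rho1.
have /boolp.choice[M M_vel] j : exists M : R,
    0 <= M /\ forall u, hnsq (velocity z j u) <= M * hnsq u.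
  by have [M M0 vel_le] := bop_ge0 (bop_velocity j bz); exists M.
have sumM0 : 0 <= \sum_(j < d) M j by apply: sumr_ge0 => j _; case: (M_vel j).
pose Q := K * \sum_(j < d) M j; have Q0 : 0 <= Q by rewrite mulr_ge0.
pose eps := (1 - psq z) / 6; have eps0 : 0 < eps by rewrite divr_gt0 // subr_gt0.
exists (Num.min (eps ^+ 2) (e / (Q + 1))); split.
  by rewrite lt_min exprn_gt0 //= divr_gt0 //; lra.
move=> l bl; rewrite Re_dotCxx lt_min => /andP[lz_eps lz_e] u.
have dl0 := psq_ge0 (ptsub l z).
have l_rho : psq l <= rho.
  by rewrite -(ptsubKC z l); apply: (psqD_le_mid (lexx _) z1 eps0) => //; exact: ltW.
set v := rowop (velocity z) (ptsub l z) u.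
have -> : \sum_(j < d) (l j - z j) *: obs A Cc z (velocity z j u) = obs A Cc z v.
  rewrite /v /rowop (lin_sum (obs_bop contrA bC bz).1); apply: eq_bigr => j _.
  by rewrite (linZ (obs_bop contrA bC bz).1).
rewrite realizes_sub // -/v; apply: le_trans (obs_le _ _ _ l_rho z_rho) _.
have v_le : hnsq v <= psq (ptsub l z) * ((\sum_(j < d) M j) * hnsq u).
  apply: le_trans (nsq_sumZ_le _ _) _; apply: ler_wpM2l => //.
  by rewrite mulr_suml; apply: ler_sum => j _; case: (M_vel j).
apply: le_trans (ler_wpM2l (mulr_ge0 K0 dl0) v_le) _.
have -> : K * psq (ptsub l z) * (psq (ptsub l z) * ((\sum_(j < d) M j) * hnsq u)) =
    Q * psq (ptsub l z) * psq (ptsub l z) * hnsq u by rewrite /Q; ring.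
apply: ler_wpM2r; first exact: nsq_ge0.
apply: ler_wpM2r => //.
have : psq (ptsub l z) * (Q + 1) <= e by rewrite -ler_pdivlMr ?ltW //; lra.
by lra.
Qed.

Lemma adj_colligation l y : inball l ->
  hadj V ([ffun j => conjc (l j) *: hadj (obs A Cc l) y], y) =
  (hadj (obs A Cc l) y, hadj (S l) y).
Proof.
move=> bl; have b_obs := obs_bop contrA bC bl.
apply: (adj_unique bV) => -[x u]; rewrite (colligation_blocks _ _ contrV.1) !hip_prod hip_pow /=.
under eq_bigr do rewrite !ffunE hipZr conjcK -hipZl.
rewrite -hip_suml -!(adjP b_obs) -(adjP (realizes_bop bl)) -!hipDl; congr (hip _ _).
have -> : \sum_(j < d) l j *: (A j x + B j u) = rowop A l x + rowop B l u.
  by rewrite /rowop -big_split; apply: eq_bigr => j _; rewrite scalerDr.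
have row_x : obs A Cc l (rowop A l x) = obs A Cc l x - Cc x.
  have -> : rowop A l x = x - pencil A l x by rewrite /pencil; hilb_ring.
  by rewrite (linB b_obs.1) /obs (pencilK contrA).
by rewrite (linD b_obs.1) row_x realS // /transfer; hilb_ring.
Qed.

End ContractiveColligation.

Lemma has_ccrP (R : realType) (d : nat) (U Y : hilb R) (S : pt R d -> U -> Y) :
  has_ccr S <-> exists (X : hilb R) (V : hprod X U -> hprod (hpow d X) Y),
    [/\ contraction V, forall i j x, colA V i (colA V j x) = colA V j (colA V i x)
      & realizes V S].
Proof.
split=> [[X [A [B [Cc [D [bA [bB [bC [bD [contrU [commA SE]]]]]]]]]]]|[X [V [contrV commA realS]]]].
  pose V (p : hprod X U) : hprod (hpow d X) Y :=
    ([ffun j => A j p.1 + B j p.2], Cc p.1 + D p.2).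
  have AE : colA V = A.
    by apply/funext => j; apply/funext => x; rewrite /colA ffunE /= (lin0 (bB j).1) addr0.
  have BE : colB V = B.
    by apply/funext => j; apply/funext => u; rewrite /colB ffunE /= (lin0 (bA j).1) add0r.
  have CE : colC V = Cc by apply/funext => x; rewrite /colC /= (lin0 bD.1) addr0.
  have DE : colD V = D by apply/funext => u; rewrite /colD /= (lin0 bC.1) add0r.
  have contrV : contraction V.
    split=> [a p q|p]; last first.
      rewrite !nsq_prod nsq_pow /=; under eq_bigr do rewrite ffunE.
      exact: contrU.
    apply: injective_projections => /=; last by rewrite bC.1 bD.1; hilb_ring.
    by apply/ffunP => j; rewrite !ffunE (bA j).1 (bB j).1; hilb_ring.
  exists X, V; split; rewrite ?AE // => l u bl.
  have [_ /(_ u)[x [xE ->]]] := SE l bl; rewrite /transfer AE BE CE DE addrC [RHS]addrC.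
  congr (Cc _ + _); have contrA := column_contraction_colA contrV; rewrite AE in contrA.
  exact/esym/(res_unique contrA).
have bV := contraction_bop contrV; have contrA := column_contraction_colA contrV.
exists X, (colA V), (colB V), (colC V), (colD V).
split; first exact: bop_colA.
split; first exact: bop_colB.
split; first exact: bop_colC.
split; first exact: bop_colD.
split; first exact: colligation_nsq_le.
split=> // l bl; split; first exact: (pencil_inj contrA bl).
move=> u; exists (res (colA V) l (rowop (colB V) l u)); split; last exact: realS.
exact: (resK contrA).
Qed.

Definition Mstar_contractive (R : realType) (d : nat) (Y : hilb R)
    (K : pt R d -> pt R d -> Y -> Y) : Prop :=
  (forall f, in_rk (@hip R Y) K f -> forall j, in_rk (@hip R Y) K (Mstar (@hip R Y) j f)) /\
  forall f, in_rk (@hip R Y) K f ->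
    \sum_(j < d) rk_nsq (@hip R Y) K (Mstar (@hip R Y) j f) <=
    rk_nsq (@hip R Y) K f - hnsq (f pt0).

Section CoisometricColligation.
Variables (R : realType) (d : nat) (X U Y : hilb R).
Variables (V : hprod X U -> hprod (hpow d X) Y) (S : pt R d -> U -> Y).
Hypothesis bV : hbop V.
Hypothesis coisoV : forall g g', hip (hadj V g) (hadj V g') = hip g g'.
Hypothesis realS : realizes V S.
Local Notation A := (colA V).
Local Notation Cc := (colC V).
Local Notation KSS := (KS (@hip R U) (@hip R Y) S).
Let contrV : contraction V := coisometry_contraction bV coisoV.
Let contrA : column_contraction A := column_contraction_colA contrV.

Let b_obs l : inball l -> hbop (obs A Cc l).
Proof. exact: (obs_bop contrA (bop_colC bV)). Qed.

Let bS l : inball l -> hbop (S l).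
Proof. exact: (realizes_bop contrV realS). Qed.

Lemma hip_KS_coisometric l z y y' : inball l -> inball z ->
  hip (KSS l z y) y' = hip (hadj (obs A Cc z) y) (hadj (obs A Cc l) y').
Proof.
move=> bl bz; rewrite (hip_KS bS) //.
have := coisoV ([ffun j => conjc (z j) *: hadj (obs A Cc z) y], y)
  ([ffun j => conjc (l j) *: hadj (obs A Cc l) y'], y').
rewrite !(adj_colligation contrV realS) // !hip_prod hip_pow /=.
under eq_bigr do rewrite !ffunE hipZl hipZr conjcK mulrA [conjc _ * _]mulrC.
rewrite -mulr_suml -dotCE; set h := hip (hadj (obs A Cc z) y) _ => eq_h.
have -> : hip y y' - hip (hadj (S z) y) (hadj (S l) y') = (1 - dotC l z) * h.
  by rewrite mulrBl mul1r; apply/eqP; rewrite subr_eq addrAC eq_sym subr_eq eq_h addrC.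
by rewrite mulrA kdK // mul1r.
Qed.

Let obs_adj_sum (s : fam d Y) : X := \sum_(p <- s) hadj (obs A Cc (sval p.1)) p.2.

Let kquad_KS_nsq s : kquad KSS s = hnsq (obs_adj_sum s).
Proof.
rewrite /kquad /nsq /obs_adj_sum hip_sumr; congr complex.Re; apply: eq_bigr => p _.
rewrite hip_suml; apply: eq_bigr => p' _.
by rewrite hip_KS_coisometric //; exact: svalP.
Qed.

Let contrS : mult_contr (@hip R U) (@hip R Y) S.
Proof.
by apply/(mult_contrP bS) => s; rewrite -subr_ge0 -(kquad_KS bS) kquad_KS_nsq nsq_ge0.
Qed.

Let pKS : pos_kernel KSS := pos_kernel_KS bS contrS.

Lemma coisometric_schur : schur (@hip R U) (@hip R Y) S.
Proof. by split=> //; split; first exact: realizes_holo realS. Qed.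

Lemma rk_bound_obs x : rk_bound (@hip R Y) KSS (fun l => obs A Cc l x) (hnsq x).
Proof.
apply/(rk_boundE pKS) => s; rewrite kquad_KS_nsq.
have -> : pairing (fun l => obs A Cc l x) s = hip x (obs_adj_sum s).
  rewrite /obs_adj_sum hip_sumr; apply: eq_bigr => p _.
  exact: adjP (b_obs (svalP p.1)) _ _.
by have := nsq_ge0 (x - obs_adj_sum s); rewrite nsqB /rip; lra.
Qed.

Lemma in_rk_obs f : in_rk (@hip R Y) KSS f -> exists2 x,
  hnsq x <= rk_nsq (@hip R Y) KSS f & forall l, inball l -> f l = obs A Cc l x.
Proof.
move=> f_in; have [H [fn rkH]] := rkhs_exists pKS.
have [|T [[_ T_le] T_adj]] := @lurking_isometry R X H (bpt R d * Y)
  (fun p => hadj (obs A Cc (sval p.1)) p.2) (fun p => rk_ker KSS fn [:: p]).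
  move=> [z y] [z' y']; rewrite (hip_rk_ker1 pKS rkH).
  exact: hip_KS_coisometric (svalP z') (svalP z).
exists (T (rk_elt fn f)); first by rewrite -(rk_nsq_elt pKS rkH f_in); exact: T_le.
move=> l bl; apply: hip_ext => y; rewrite (adjP_sym (b_obs bl)).
rewrite (T_adj (exist _ l bl, y)) [RHS]hip_sym (rk_reproducing1 pKS rkH) /=.
by rewrite (rk_eltE rkH) // -hip_sym.
Qed.

Hypothesis commA : forall i j x, A i (A j x) = A j (A i x).

Lemma coisometric_Mstar_contractive : Mstar_contractive KSS.
Proof.
have bound_Mstar f x j : in_rk (@hip R Y) KSS f -> (forall l, inball l -> f l = obs A Cc l x) ->
    rk_bound (@hip R Y) KSS (Mstar (@hip R Y) j f) (hnsq (A j x)).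
  move=> f_in f_obs; apply: (eq_rk_bound pKS) (rk_bound_obs (A j x)) => l bl.
  rewrite (Mstar_obs j contrA (bop_colC bV) commA _ f_obs bl) //.
  exact: (in_rk_KS_kd bS contrS f_in).
split=> f f_in; have [x x_le f_obs] := in_rk_obs f_in.
  by move=> j; exists (hnsq (A j x)); exact: bound_Mstar.
have f0 : f pt0 = Cc x by rewrite f_obs; [exact: obs0 contrA _ | exact: inball0].
have : \sum_(j < d) rk_nsq (@hip R Y) KSS (Mstar (@hip R Y) j f) <= \sum_(j < d) hnsq (A j x).
  by apply: ler_sum => j _; apply: rk_nsq_le; exact: bound_Mstar.
by rewrite f0; have := colAC_nsq_le contrV x; lra.
Qed.

End CoisometricColligation.

Lemma coisometric_completion (R : realType) (H G : hilb R) (V : H -> G) : contraction V ->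
  exists (F : hilb R) (T : F -> G), contraction T /\
    forall g g', hip (hadj V g) (hadj V g') + hip (hadj T g) (hadj T g') = hip g g'.
Proof.
move=> /contraction_adj contrVs; have [F [tau [contr_tau tauE]]] := defect_operator contrVs.
have b_tau := contraction_bop contr_tau; exists F, (hadj tau); split; first exact: contraction_adj.
have adjK g : hadj (hadj tau) g = tau g.
  by apply: (adj_unique (bop_adj b_tau)) => f; rewrite adjP_sym.
by move=> g g'; rewrite !adjK tauE addrC subrK.
Qed.

Lemma coisometric_input_extension (R : realType) (X U G : hilb R) (V : hprod X U -> G) :
  contraction V -> exists (F : hilb R) (Vh : hprod X (hprod U F) -> G),
    [/\ hbop Vh, forall g g', hip (hadj Vh g) (hadj Vh g') = hip g g'
      & forall x u, Vh (x, (u, 0)) = V (x, u)].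
Proof.
move=> contrV; have [F [T [contrT coiso]]] := coisometric_completion contrV.
have [bV bT] := (contraction_bop contrV, contraction_bop contrT).
pose Vh (p : hprod X (hprod U F)) : G := V (p.1, p.2.1) + T p.2.2.
have bVh : hbop Vh.
  apply: bopD.
    apply: (bop_comp (T := fun p : hprod X (hprod U F) => (p.1, p.2.1) : hprod X U) _ bV).
    apply: contraction_bop; split=> // p.
    by rewrite !nsq_prod /= addrA lerDl nsq_ge0.
  apply: (bop_comp (T := fun p : hprod X (hprod U F) => p.2.2) _ bT).
  apply: contraction_bop; split=> // p.
  by rewrite !nsq_prod addrA lerDr addr_ge0 ?nsq_ge0.
have adjVh g : hadj Vh g = ((hadj V g).1, ((hadj V g).2, hadj T g)).
  apply: (adj_unique bVh) => -[x [u f]].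
  by rewrite hipDl (adjP bV) (adjP bT) !hip_prod /= addrA.
exists F, Vh; split=> [//|g g'|x u]; last by rewrite /Vh /= (lin0 contrT.1) addr0.
by rewrite !adjVh -coiso !hip_prod /= addrA.
Qed.

Lemma ccr_extension (R : realType) (d : nat) (U Y : hilb R) (S : pt R d -> U -> Y) :
  has_ccr S -> exists (F : hilb R) (St : pt R d -> F -> Y),
    let Sh : pt R d -> hprod U F -> Y := fun l p => S l p.1 + St l p.2 in
    schur (@hip R (hprod U F)) (@hip R Y) Sh /\
    Mstar_contractive (KS (@hip R (hprod U F)) (@hip R Y) Sh).
Proof.
move=> /has_ccrP[X [V [contrV commA realS]]].
have [F [Vh [bVh coisoVh Vh_V]]] := coisometric_input_extension contrV.
have AE : colA Vh = colA V.
  by apply/funext => j; apply/funext => x; rewrite /colA -Vh_V.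
have CE : colC Vh = colC V by apply/funext => x; rewrite /colC -Vh_V.
have transfer_Vh l u : transfer Vh l (u, 0) = transfer V l u.
  rewrite /transfer AE CE /colD Vh_V; congr (_ + obs _ _ _ _).
  by apply: eq_bigr => j _; rewrite /colB Vh_V.
exists F, (fun l f => transfer Vh l (0, f)) => Sh.
have realSh : realizes Vh Sh.
  move=> l [u f] bl; have [linVh _] := realizes_bop (coisometry_contraction bVh coisoVh)
    (S := transfer Vh) (fun _ _ _ => erefl) bl.
  rewrite /Sh /= realS // -transfer_Vh -(linD linVh); congr (transfer _ _ _).
  by apply: injective_projections; rewrite /= ?addr0 ?add0r.
split; first exact: coisometric_schur coisoVh realSh.
by apply: (coisometric_Mstar_contractive bVh coisoVh realSh); rewrite AE.
Qed.

(** * The functional model *)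

Lemma contraction_defect_row (R : realType) (X U G F : hilb R) (Vx : X -> G) (tau : G -> F)
    (T : U -> F) : contraction Vx -> contraction tau -> contraction T ->
  (forall g g', hip (tau g) (tau g') = hip g g' - hip (hadj Vx g) (hadj Vx g')) ->
  contraction (fun p : hprod X U => Vx p.1 + hadj tau (T p.2)).
Proof.
move=> contrV contr_tau contrT tauE.
have [bV b_tau] := (contraction_bop contrV, contraction_bop contr_tau).
split=> [a p q|[x u]]; first by rewrite contrV.1 contrT.1 (adj_linear b_tau); hilb_ring.
rewrite nsq_prod /=; set g := _ + _.
have nsq_g : hnsq g = rip x (hadj Vx g) + rip (T u) (tau g).
  by rewrite nsqE {1}/g ripDl /rip (adjP bV) -(adjP_sym b_tau).
have nsq_tau : hnsq (tau g) = hnsq g - hnsq (hadj Vx g) by rewrite /nsq tauE ReB.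
have := amgm (nsq_ge0 x) (nsq_ge0 _) (rip_CauchySchwarz x (hadj Vx g)).
have := amgm (nsq_ge0 (T u)) (nsq_ge0 _) (rip_CauchySchwarz (T u) (tau g)).
by have := contrT.2 u; lra.
Qed.

Section FunctionalModel.
Variables (R : realType) (d : nat) (U Y : hilb R) (S : pt R d -> U -> Y).
Hypothesis bS : forall l, inball l -> hbop (S l).
Hypothesis contrS : mult_contr (@hip R U) (@hip R Y) S.
Local Notation KSS := (KS (@hip R U) (@hip R Y) S).
Local Notation M := (@Mstar R d Y (@hip R Y)).
Hypothesis contrM : Mstar_contractive KSS.
Let pKS : pos_kernel KSS := pos_kernel_KS bS contrS.

Variables (X : hilb R) (fn : X -> pt R d -> Y).
Hypothesis rkX : is_rkhs KSS fn.
Variable A : 'I_d -> X -> X.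
Hypothesis AE : forall j x l, inball l -> fn (A j x) l = M j (fn x) l.
Implicit Types (x : X) (z : bpt R d).

Let fn_in_kd x : in_rk (@hip R Y) (@kdI R d Y) (fn x).
Proof. exact: (in_rk_KS_kd bS contrS (rkhs_in_rk rkX x)). Qed.

Let A_linear j : linear (A j).
Proof.
move=> a x y; apply: (rkhs_ext rkX) => l bl; rewrite (rkhs_linear rkX) !AE //.
rewrite -(Mstar_linear _ _ (fn_in_kd x) (fn_in_kd y) bl).
by apply: eq_Mstar => // z _; exact: (rkhs_linear rkX).
Qed.

Let A_comm i j x : A i (A j x) = A j (A i x).
Proof.
apply: (rkhs_ext rkX) => l bl; rewrite !AE //.
rewrite (eq_Mstar i (fn_in_kd (A j x)) (@AE j x) bl).
rewrite (eq_Mstar j (fn_in_kd (A i x)) (@AE i x) bl).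
exact: Mstar_comm.
Qed.

Let A_gleason x l : inball l -> fn x l - fn x pt0 = \sum_(j < d) l j *: fn (A j x) l.
Proof.
move=> bl; rewrite (Mstar_gleason (fn_in_kd x) bl).
by apply: eq_bigr => j _; rewrite AE.
Qed.

Let G := hprod (hpow d X) Y.

Let model_col x : G := ([ffun j => A j x], fn x pt0).

Let contraction_model_col : contraction model_col.
Proof.
split=> [a x y|x].
  apply: injective_projections => /=; last exact: (rkhs_linear rkX).
  by apply/ffunP => j; rewrite !ffunE A_linear.
have := contrM.2 _ (rkhs_in_rk rkX x); rewrite nsq_prod nsq_pow -(rkhs_nsq rkX) lerBrDr.
apply: le_trans; rewrite lerD2r; apply: ler_sum => j _.
by rewrite ffunE (rkhs_nsq rkX) (eq_rk_nsq pKS (g := M j (fn x))) // => l bl; exact: AE.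
Qed.

Let ker z y : X := rk_ker KSS fn [:: (z, y)].

Let shifted_ker z y : G := ([ffun j => conjc (sval z j) *: ker z y], y).

Let adj_model_col z y : hadj model_col (shifted_ker z y) = ker z y.
Proof.
apply: (adj_unique (contraction_bop contraction_model_col)) => x.
rewrite hip_prod hip_pow /= (rk_reproducing1 pKS rkX).
under eq_bigr do rewrite !ffunE hipZr conjcK (rk_reproducing1 pKS rkX) -hipZl.
by rewrite -hip_suml -A_gleason -?hipDl ?subrK //; exact: svalP.
Qed.

Let gram_shifted_ker z y z' y' :
  hip (shifted_ker z y) (shifted_ker z' y') - hip (ker z y) (ker z' y') =
  hip (hadj (S (sval z)) y) (hadj (S (sval z')) y').
Proof.
have [bz bz'] := (svalP z, svalP z'); rewrite hip_prod hip_pow /=.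
under eq_bigr do rewrite !ffunE hipZl hipZr conjcK mulrA [conjc _ * _]mulrC.
rewrite -mulr_suml -dotCE (hip_rk_ker1 pKS rkX) (hip_KS bS) //.
set k := kd _ _; set c := dotC _ _; set a := hip y y'; set b := hip (hadj _ _) _.
have -> : c * (k * (a - b)) + a - k * (a - b) = a - k * (1 - c) * (a - b) by ring.
by rewrite kdK // mul1r opprB addrC subrK.
Qed.

Lemma has_ccr_of_rkhs : has_ccr S.
Proof.
have contrV0 := contraction_model_col; have bV0 := contraction_bop contrV0.
have [F [tau [contr_tau tauE]]] := defect_operator (contraction_adj contrV0).
have b_tau := contraction_bop contr_tau.
have [|T [contrT T_adj]] := @lurking_isometry R F U (bpt R d * Y)
    (fun p => tau (shifted_ker p.1 p.2)) (fun p => hadj (S (sval p.1)) p.2).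
  by move=> [z y] [z' y']; rewrite tauE !adj_model_col gram_shifted_ker.
pose V (p : hprod X U) : G := model_col p.1 + hadj tau (T p.2).
have contrV : contraction V by exact: contraction_defect_row contrV0 contr_tau contrT tauE.
have linW : linear (hadj tau) := adj_linear b_tau.
have V_inl x : V (x, 0) = model_col x.
  by rewrite /V /= (lin0 contrT.1) (lin0 linW) addr0.
have V_inr u : V (0, u) = hadj tau (T u) by rewrite /V /= (lin0 contrV0.1) add0r.
have VA : colA V = A.
  by apply/funext => j; apply/funext => x; rewrite /colA V_inl ffunE.
have VC : colC V = fun x => fn x pt0 by apply/funext => x; rewrite /colC V_inl.
apply/has_ccrP; exists X, V; split; [exact: contrV | by rewrite VA; exact: A_comm | move=> l u bl].
have contrA := column_contraction_colA contrV; rewrite VA in contrA.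
rewrite /transfer VA VC (obs_of_gleason contrA (rkhs_linear rkX) A_gleason) //.
rewrite /rowop (lin_sum (rkhs_linear rkX l)); apply: hip_ext => y.
pose lb : bpt R d := exist _ l bl.
rewrite (adjP_sym (bS bl)) -(T_adj (lb, y) u) (adjP b_tau) -V_inr hip_prod hipDr addrC.
rewrite hip_sumr hip_pow; congr (_ + _); apply: eq_bigr => j _.
have -> : (shifted_ker lb y).1 j = conjc (l j) *: ker lb y by rewrite ffunE.
rewrite hipZl (linZ (rkhs_linear rkX l)) hipZr; congr (_ * _).
by rewrite hip_sym (rk_reproducing1 pKS rkX) -hip_sym.
Qed.

End FunctionalModel.

Lemma has_ccr_of_Mstar_contractive (R : realType) (d : nat) (U Y : hilb R)
    (S : pt R d -> U -> Y) :
  (forall l, inball l -> hbop (S l)) -> mult_contr (@hip R U) (@hip R Y) S ->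
  Mstar_contractive (KS (@hip R U) (@hip R Y) S) -> has_ccr S.
Proof.
move=> bS contrS contrM.
have [X [fn rkX]] := rkhs_exists (pos_kernel_KS bS contrS).
pose A j x := rk_elt fn (Mstar (@hip R Y) j (fn x)).
have AE j x l : inball l -> fn (A j x) l = Mstar (@hip R Y) j (fn x) l.
  by apply: (rk_eltE rkX); exact: contrM.1 (rkhs_in_rk rkX x) j.
exact: (has_ccr_of_rkhs bS contrS contrM rkX AE).
Qed.

Lemma ccr_restriction (R : realType) (d : nat) (U F Y : hilb R) (S : pt R d -> U -> Y)
    (Sh : pt R d -> hprod U F -> Y) :
  (forall l u, inball l -> Sh l (u, 0) = S l u) -> has_ccr Sh -> has_ccr S.
Proof.
move=> ShS /has_ccrP[X [V [contrV commA realSh]]]; apply/has_ccrP.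
pose inj (p : hprod X U) : hprod X (hprod U F) := (p.1, (p.2, 0)).
exists X, (fun p => V (inj p)); split=> [|//|l u bl]; last by rewrite -ShS // realSh.
split=> [a p q|p].
  rewrite -contrV.1; congr (V _).
  by rewrite /inj; congr (_, _); apply: injective_projections; rewrite //= scaler0 addr0.
by apply: le_trans (contrV.2 _) _; rewrite !nsq_prod /= nsq0 addr0.
Qed.

Theorem theorem3p10 (R : realType) (d : nat) (U Y : hilb R) (S : pt R d -> U -> Y) :
  schur (@hip R U) (@hip R Y) S ->
  (has_ccr S <->
   exists (F : hilb R) (St : pt R d -> F -> Y),
     let Sh := fun (l : pt R d) (p : (U * F)%type) => S l p.1 + St l p.2 in
     let KSh := KS (ipsum (@hip R U) (@hip R F)) (@hip R Y) Sh in
     schur (ipsum (@hip R U) (@hip R F)) (@hip R Y) Sh /\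
     (forall f : pt R d -> Y, in_rk (@hip R Y) KSh f ->
        forall j : 'I_d, in_rk (@hip R Y) KSh (Mstar (@hip R Y) j f)) /\
     (forall f : pt R d -> Y, in_rk (@hip R Y) KSh f ->
        \sum_(j < d) rk_nsq (@hip R Y) KSh (Mstar (@hip R Y) j f)
          <= rk_nsq (@hip R Y) KSh f - nsq (@hip R Y) (f pt0))).
Proof.
move=> [bS _]; split; first exact: ccr_extension.
move=> [F [St [[bSh [_ contrSh]] contrM]]].
pose Sh l (p : hprod U F) := S l p.1 + St l p.2.
apply: (@ccr_restriction R d U F Y S Sh) => [l u bl|].
  have : Sh l 0 = 0 := lin0 (bSh l bl).1.
  by rewrite /Sh /= (lin0 (bS l bl).1) add0r => ->; rewrite addr0.
exact: (@has_ccr_of_Mstar_contractive R d (hprod U F) Y Sh).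
Qed.
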